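(* Let $S$ be a numerical semigroup whose semigroup polynomial $\mathrm{P}_S$ has at most two irreducible factors, counted with multiplicity. Then $S$ is cyclotomic if and only if $S$ is complete intersection.
   Context: $\mathbb{N}$ denotes the non-negative integers. A numerical semigroup $S$ is an additive submonoid of $\mathbb{N}$ with finite complement in $\mathbb{N}$. The semigroup polynomial of $S$ is $\mathrm{P}_S(x) = 1 + (x-1) \sum_{g \in \mathbb{N} \setminus S} x^g$. Irreducible factors are taken over the rationals. $S$ is cyclotomic if $\mathrm{P}_S$ is a (possibly empty) product of cyclotomic polynomials, with repetitions allowed. Every numerical semigroup has a unique minimal generating system; its cardinality is the embedding dimension $\mathrm{e}(S)$. If $n_1,\dots,n_e$ are the minimal generators of $S$, a minimal presentation of $S$ is a minimal generating set of the kernel congruence $\{(u,v)\in\mathbb{N}^e\times\mathbb{N}^e : \sum u_in_i=\sum v_in_i\}$ of the monoid map $\mathbb{N}^e\to S$, $u\mapsto\sum u_in_i$; $S$ is complete intersection if the cardinality of a minimal presentation equals $\mathrm{e}(S)-1$. Equivalently (a known characterisation, which the paper uses as its working description): $S$ is complete intersection if and only if $S=\mathbb{N}$ or $S$ is a gluing of two complete intersection numerical semigroups, where $S$ is a gluing of numerical semigroups $S_1$ and $S_2$ if $S=a_1S_1+a_2S_2$ for some coprime integers $a_1\in S_2$, $a_2\in S_1$ that are not minimal generators of $S_2$, $S_1$ respectively. *)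

(* Defs.v *)
From mathcomp Require Import all_boot all_order all_algebra all_field.
From mathcomp Require Import mathcomp_extra boolp classical_sets functions.
From mathcomp Require Import cardinality fsbigop.

Set Implicit Arguments.
Unset Strict Implicit.
Unset Printing Implicit Defensive.

Import GRing.Theory.

Local Open Scope classical_set_scope.
Local Open Scope card_scope.
Local Open Scope ring_scope.

Definition submonoid (S : set nat) : Prop :=
  S 0%N /\ forall x y, S x -> S y -> S (x + y)%N.

Definition numerical_semigroup (S : set nat) : Prop :=
  submonoid S /\ finite_set (~` S).

Definition semigroup_poly (S : set nat) : {poly rat} :=
  1 + ('X - 1) * \sum_(g \in ~` S) ('X^g : {poly rat}).

(* The unit allowed by [%=] makes this independent of the normalisation of the
   factors; a nonzero constant has the empty factorisation. *)
Definition irreducible_factorization (p : {poly rat}) (s : seq {poly rat}) :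
    Prop :=
  (forall q, q \in s -> irreducible_poly q) /\ p %= \prod_(q <- s) q.

Definition cyclotomic_semigroup (S : set nat) : Prop :=
  exists2 s : seq nat, all (fun n => 0 < n)%N s &
    semigroup_poly S = \prod_(n <- s) map_poly intr 'Phi_n.

(* [smallest C G] is the closure of G in the closure system C: the submonoid
   generated by G if C is [submonoid], the congruence generated by G if C is
   [congruence]. *)
Definition minimal_generating_set (T : Type) (C : set T -> Prop)
    (A G : set T) : Prop :=
  smallest C G = A /\ forall H, H `<=` G -> smallest C H = A -> H = G.

Definition congruence (M : nmodType) (c : set (M * M)) : Prop :=
  [/\ forall u, c (u, u),
      forall u v, c (u, v) -> c (v, u),
      forall u v w, c (u, v) -> c (v, w) -> c (u, w) &
      forall u v w, c (u, v) -> c (u + w, v + w)].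

Definition kernel_congruence (e : nat) (n : 'I_e -> nat) :
    set ({ffun 'I_e -> nat} * {ffun 'I_e -> nat}) :=
  [set p : {ffun 'I_e -> nat} * {ffun 'I_e -> nat} |
    (\sum_(i < e) p.1 i * n i)%N = (\sum_(i < e) p.2 i * n i)%N].

Definition minimal_presentation (e : nat) (n : 'I_e -> nat)
    (rho : set ({ffun 'I_e -> nat} * {ffun 'I_e -> nat})) : Prop :=
  minimal_generating_set (@congruence {ffun 'I_e -> nat})
    (kernel_congruence n) rho.

(* [n] enumerates the minimal generators without repetition, so [e] is the
   embedding dimension; it is positive for a numerical semigroup, so the
   predecessor is not truncated. *)
Definition complete_intersection (S : set nat) : Prop :=
  exists (e : nat) (n : 'I_e -> nat)
    (rho : set ({ffun 'I_e -> nat} * {ffun 'I_e -> nat})),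
    [/\ injective n,
        minimal_generating_set submonoid S (range n),
        minimal_presentation n rho &
        rho #= `I_(e.-1)].

(* Main.v *)
(* Complete intersection => cyclotomic, for every numerical semigroup.  Let the
   minimal generators be n_1, ..., n_e and let the e - 1 pairs (u_k, v_k) generate
   the kernel congruence.  A 0-1 point of the variety of the binomials
   x^(u_k) - x^(v_k) whose zero set Z is a proper nonempty set of coordinates would
   yield a congruence (does the support meet Z?) containing all the pairs but not
   the kernel.  Hence every nonempty set Z of coordinates is met by both sides of
   fewer than #|Z| pairs, and this Hall-type condition arranges the pairs into a
   binary tree on the coordinates: at each node u_k lives on one block, v_k on the
   other.  Each node contributes a factor 1 - X^d to the Hilbert series, so
   P_S * prod (1 - X^(n_i)) = (1 - X) * prod (1 - X^(d_k)), and all the factors of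
   P_S are cyclotomic.

   Cyclotomic => complete intersection.  P_S is a product of at most two cyclotomic
   polynomials, and its coefficient of X is -1 when 1 is not in S, whereas the one
   of Phi_n is minus the Moebius function of n.  So some factor is Phi_n with n a
   product of an even number of distinct primes p < q < ..., and the other one, if
   any, is Phi_r(X^t) with r squarefree and t > 1.  If S contains coprime a and b
   then P_S has degree at most (a - 1)(b - 1); reading off small elements of S from
   P_S modulo powers of X, this bound forces n = p q and t in {p, q}.  Then
   S = <p, q>, or S = t <u, v> + b N with {t, b} = {p, q} and r = u v, a gluing,
   for which minimal presentations are explicit. *)
Require Import Defs.
From mathcomp Require Import all_boot all_order all_algebra all_field.
From mathcomp Require Import mathcomp_extra boolp classical_sets functions.
From mathcomp Require Import cardinality fsbigop.
From mathcomp Require Import finmap zify ring lra.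

Set Implicit Arguments.
Unset Strict Implicit.
Unset Printing Implicit Defensive.

Import Order.TTheory GRing.Theory Num.Theory.

(** * Systems of rows and gluing trees *)

Section RowSystems.
Import fintype boot.finset.
Local Open Scope nat_scope.
Variables (T J : finType).
Implicit Types (U V : J -> {set T}) (K : {set J}) (D I Z : {set T}).

Definition mixed_rows U V K I :=
  [set k in K | ~~ [disjoint U k & I] && ~~ [disjoint V k & I]].

(** When every side is a singleton inside [D], this says that the rows are the edges of a forest; in
    general it is a strict Hall-type condition. *)
Definition sparse_rows U V K D :=
  forall I, I \subset D -> I != set0 -> #|mixed_rows U V K I| < #|I|.

Lemma mixed_rowsS U V K I1 I2 :
  I1 \subset I2 -> mixed_rows U V K I1 \subset mixed_rows U V K I2.
Proof.
move=> sI; apply/subsetP => k; rewrite !inE => /and3P[-> hU hV] /=.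
by apply/andP; split; [apply: contra hU|apply: contra hV]; apply: disjointWr.
Qed.

(* A maximal [Z] avoiding [x] with [#|Z|.-1] mixed rows can only be left
   through a row having [[set x]] as one side: otherwise all the remaining
   rows live on [D :\: Z], too many for sparseness. *)
Lemma sparse_rows_side U V K D x :
    sparse_rows U V K D -> #|D| = #|K|.+1 -> 1 < #|D| -> x \in D ->
    (forall k, k \in K -> [/\ U k \subset D, V k \subset D,
                              U k != set0 & V k != set0]) ->
  exists2 k, k \in K & (U k == [set x]) || (V k == [set x]).
Proof.
move=> sp cD gt1 xD hK; apply/exists_inP; apply: contraT.
rewrite negb_exists_in => /forall_inP nx.
have [z zD] : exists z, z \in D :\ x.
  by apply/set0Pn; rewrite -card_gt0; move: gt1; rewrite (cardsD1 x D) xD.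
pose good Z := [&& Z \subset D :\ x, Z != set0
                 & #|Z| <= #|mixed_rows U V K Z|.+1].
have gz : good [set z].
  by rewrite /good sub1set zD cards1 ltnS leq0n andbT -card_gt0 cards1.
case: (arg_maxnP (fun Z => #|Z|) gz) => Z /and3P[ZD Z0 cZ] Zmax.
(* Otherwise a point of [W'] other than [x] could be added to [Z]: the row [k] becomes mixed,
   against the maximality of [Z]. *)
have stable k W W' : k \in K ->
    (W = U k /\ W' = V k) \/ (W = V k /\ W' = U k) ->
    ~~ [disjoint W & Z] -> ~~ [disjoint W' & Z].
  move=> kK hW mW; apply/negP => dW'.
  have [W'D W'0 W'x] : [/\ W' \subset D, W' != set0 & W' != [set x]].
    have [? ? ? ?] := hK k kK; have := nx k kK; rewrite negb_or => /andP[? ?].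
    by case: hW => -[_ ->].
  have [y yW' yx] : exists2 y, y \in W' & y != x.
    apply/exists_inP; apply: contraR W'x; rewrite negb_exists_in.
    move=> /forall_inP h; rewrite eqEsubset andbC.
    have sW' : W' \subset [set x].
      by apply/subsetP => y /h; rewrite negbK inE.
    rewrite sW' andbT; case/set0Pn: W'0 => y yW'.
    by have := subsetP sW' _ yW'; rewrite inE sub1set => /eqP <-.
  have yZ : y \notin Z by have /pred0P /(_ y) /= := dW'; rewrite yW' /= => ->.
  have cyZ : #|y |: Z| = #|Z|.+1 by rewrite cardsU1 yZ.
  have : good (y |: Z).
    apply/and3P; split.
    - by rewrite subUset sub1set ZD andbT !inE yx (subsetP W'D).
    - by apply/set0Pn; exists y; rewrite !inE eqxx.
    rewrite cyZ ltnS (leq_trans cZ) //.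
    apply: proper_card; rewrite properE mixed_rowsS ?subsetUr //=.
    apply/subsetPn; exists k; rewrite !inE kK /=.
      have h1 : ~~ [disjoint W & y |: Z].
        by apply: contra mW; apply: disjointWr; apply: subsetUr.
      have h2 : ~~ [disjoint W' & y |: Z].
        by apply/negP => /pred0P /(_ y); rewrite /= yW' !inE eqxx.
      by case: hW => -[eW eW']; move: h1 h2; rewrite eW eW' => -> ->.
    by case: hW => -[_ <-]; rewrite dW' ?andbF.
  by move=> /Zmax /=; rewrite cyZ ltnn.
have xZ : x \in D :\: Z.
  rewrite inE xD andbT; apply/negP => /(subsetP ZD).
  by rewrite !inE eqxx.
have ZsD : Z \subset D by apply: subset_trans ZD (subsetDl _ _).
have := sp (D :\: Z) (subsetDl _ _).
have -> : D :\: Z != set0 by apply/set0Pn; exists x.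
move=> /(_ isT).
have sub : K :\: mixed_rows U V K Z \subset mixed_rows U V K (D :\: Z).
  apply/subsetP => k; rewrite !inE => /andP[+ kK]; rewrite kK /= => nm.
  have [UD VD U0 V0] := hK k kK.
  have key (W W' : {set T}) : (W = U k /\ W' = V k) \/ (W = V k /\ W' = U k) ->
      ~~ [disjoint W & D :\: Z].
    move=> hW.
    have dW : [disjoint W & Z].
      apply: contraNT nm => mW; have mW' := stable k W W' kK hW mW.
      by case: hW => -[eW eW']; move: mW mW'; rewrite eW eW' => -> ->.
    have [/set0Pn[y yW] WD] : W != set0 /\ W \subset D by case: hW => -[->].
    apply/negP => /pred0P /(_ y) /=; rewrite yW !inE (subsetP WD) // andbT.
    by have /pred0P /(_ y) /= := dW; rewrite yW /= => ->.
  by rewrite (key (U k) (V k)) ?(key (V k) (U k)); auto.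
have := subset_leq_card sub.
have := cardsID (mixed_rows U V K Z) K.
have -> : K :&: mixed_rows U V K Z = mixed_rows U V K Z.
  by apply/setIidPr/subsetP => k; rewrite inE => /andP[].
have := cardsID Z D; rewrite (setIidPr ZsD).
have := sp Z ZsD Z0.
by lia.
Qed.

(** By [sparse_rows_side] every point is a singleton side of some row. If no row had two singleton
    sides, this choice would inject [D] into [K], which has one element fewer. *)
Lemma sparse_rows_bottom U V K D :
    sparse_rows U V K D -> #|D| = #|K|.+1 -> 1 < #|D| ->
    (forall k, k \in K -> [/\ U k \subset D, V k \subset D,
                              U k != set0 & V k != set0]) ->
  exists2 k, k \in K & (#|U k| == 1) && (#|V k| == 1).
Proof.
move=> sp cD gt1 hK; apply/exists_inP; apply: contraT.
rewrite negb_exists_in => /forall_inP nb.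
have [k0 k0K] : exists k, k \in K.
  by apply/set0Pn; rewrite -card_gt0 -ltnS -cD.
have side x : x \in D -> exists k, (k \in K) && ((U k == [set x]) || (V k == [set x])).
  by move=> xD; have [k kK h] := sparse_rows_side sp cD gt1 xD hK; exists k; apply/andP.
pose g x := odflt k0 [pick k in K | (U k == [set x]) || (V k == [set x])].
have gP x : x \in D -> (g x \in K) && ((U (g x) == [set x]) || (V (g x) == [set x])).
  move=> xD; rewrite /g; case: pickP => [k //|/= no].
  by have [k] := side x xD; rewrite no.
have inj : {in D &, injective g}.
  move=> x y /gP /andP[xK hx] /gP /andP[_ hy] e; move: hx hy xK; rewrite -e.
  move: (g x) => k hx hy kK; apply/eqP.
  case/orP: hx => /eqP ex; case/orP: hy => /eqP ey.
  - by rewrite -in_set1 -ey ex set11.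
  - by have := nb k kK; rewrite ex ey !cards1.
  - by have := nb k kK; rewrite ex ey !cards1.
  - by rewrite -in_set1 -ey ex set11.
have : #|D| <= #|K|.
  rewrite -(card_in_imset inj); apply/subset_leq_card/subsetP => _ /imsetP[x xD ->].
  by case/andP: (gP x xD).
by rewrite cD ltnn.
Qed.

(** The combinatorial shadow of iterated gluing: the row at a node links the two blocks that it
    merges. *)
Inductive gluing_tree U V : {set T} -> {set J} -> Prop :=
| GluingLeaf i : gluing_tree U V [set i] set0
| GluingNode C1 C2 K1 K2 j :
    gluing_tree U V C1 K1 -> gluing_tree U V C2 K2 -> [disjoint C1 & C2] ->
    U j \subset C1 -> V j \subset C2 ->
    gluing_tree U V (C1 :|: C2) (j |: (K1 :|: K2)).

End RowSystems.

Section GluingTrees.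
Import fintype boot.finset.
Local Open Scope nat_scope.

Lemma gluing_tree_rows (T J : finType) (U V : J -> {set T}) C K k :
  gluing_tree U V C K -> k \in K -> U k \subset C /\ V k \subset C.
Proof.
elim=> [i|C1 C2 K1 K2 j _ IH1 _ IH2 _ Uj Vj]; first by rewrite inE.
have s1 := subsetUl C1 C2; have s2 := subsetUr C1 C2.
rewrite !inE => /or3P[/eqP->|/IH1[? ?]|/IH2[? ?]].
- by split; [apply: subset_trans Uj s1|apply: subset_trans Vj s2].
- by split; apply: subset_trans s1.
- by split; apply: subset_trans s2.
Qed.

(* [f] labels each element by its block; the blocks are the fibres of [f], and
   the row found by [sparse_rows_bottom] joins two of them. *)
Lemma sparse_rows_tree_of_blocks (T J : finType) (U V : J -> {set T})
    (D : {set T}) (K : {set J}) (f : T -> T) :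
    (forall k, U k != set0 /\ V k != set0) ->
    (forall i, f i \in D) ->
    (forall x, x \in D -> exists L, gluing_tree U V [set i | f i == x] L) ->
    sparse_rows (fun k => f @: U k) (fun k => f @: V k) K D ->
    #|D| = #|K|.+1 ->
  exists L, gluing_tree U V [set: T] L.
Proof.
move=> ne; have [m] := ubnP #|D|; elim: m => // m IHm in D K f *.
rewrite ltnS => cm fD blk sp cD.
have [|gt1] := leqP #|D| 1.
  rewrite leq_eqVlt ltnS leqn0 [#|D| == 0]eqn0Ngt {2}cD orbF => /cards1P[x Dx].
  have [|L] := blk x; first by rewrite Dx inE.
  suff -> : [set i | f i == x] = [set: T] by exists L.
  by apply/setP => i; have := fD i; rewrite Dx !inE.
have fsub (W : {set T}) : f @: W \subset D by apply/subsetP => _ /imsetP[i _ ->].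
have ne' (W : {set T}) : W != set0 -> f @: W != set0.
  by case/set0Pn => i iW; apply/set0Pn; exists (f i); apply: imset_f.
have [|j jK /andP[/cards1P[a Ua] /cards1P[b Vb]]] :=
    sparse_rows_bottom sp cD gt1.
  by move=> k _; have [? ?] := ne k; split=> //; apply: ne'.
have aD : a \in D by rewrite -sub1set -Ua.
have bD : b \in D by rewrite -sub1set -Vb.
have ab : a != b.
  apply/eqP => ab; have := sp [set a]; rewrite sub1set aD => /(_ isT).
  have -> : [set a] != set0 by apply/set0Pn; exists a; rewrite inE.
  move=> /(_ isT); rewrite cards1 ltnS leqn0 cards_eq0 => /eqP e.
  have : j \in mixed_rows (fun k => f @: U k) (fun k => f @: V k) K [set a].
    by rewrite inE jK Ua Vb -ab -!setI_eq0 setIid -card_gt0 cards1.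
  by rewrite e inE.
(* Merging the blocks labelled [a] and [b] amounts to relabelling [b] by [a]. *)
pose h x := if x == b then a else x.
have img (W I : {set T}) : [disjoint (h \o f) @: W & I] =
    [disjoint f @: W & if a \in I then b |: I else I :\ b].
  rewrite imset_comp; move: (f @: W) => {}W.
  apply/idP/idP => dis; rewrite disjoint_subset; apply/subsetP => x.
    move=> xW; rewrite inE; have /(disjointFr dis) : h x \in h @: W by apply: imset_f.
    rewrite /h; case: (eqVneq x b) => [->|xb] e.
      by rewrite e !inE eqxx.
    by case: ifP => _; rewrite !inE (negPf xb) ?e.
  case/imsetP => y yW ->; rewrite inE; have := disjointFr dis yW; rewrite /h.
  by case: (eqVneq y b) => [->|yb]; case: ifP => aI; rewrite !inE ?eqxx ?(negPf yb) //= => ->.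
apply: (IHm (D :\ b) (K :\ j) (h \o f)).
- by move: cm; rewrite (cardsD1 b D) bD; lia.
- by move=> i /=; rewrite /h !inE; case: (eqVneq (f i) b) => [_|->]; rewrite ?ab ?aD ?fD.
- move=> x; rewrite !inE => /andP[xb xD].
  have [xa|xa] := eqVneq x a.
    have [L1 T1] := blk a aD; have [L2 T2] := blk b bD.
    exists (j |: (L1 :|: L2)).
    have -> : [set i | (h \o f) i == x] = [set i | f i == a] :|: [set i | f i == b].
      apply/setP => i; rewrite !inE /= /h xa.
      by case: (eqVneq (f i) b) => _; rewrite ?eqxx ?orbT ?orbF.
    have pre (W : {set T}) c : f @: W = [set c] -> W \subset [set i | f i == c].
      move=> e; apply/subsetP => i iW; rewrite inE -in_set1 -e.
      exact: imset_f.
    apply: GluingNode => //; try exact: pre.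
    apply/pred0P => i /=; rewrite !inE; apply/negP => /andP[/eqP-> /eqP e].
    by rewrite e eqxx in ab.
  have [L TL] := blk x xD; exists L.
  suff -> : [set i | (h \o f) i == x] = [set i | f i == x] by [].
  apply/setP => i; rewrite !inE /= /h; case: (eqVneq (f i) b) => [->|//].
  by rewrite [b == x]eq_sym (negPf xb) [a == x]eq_sym (negPf xa).
- move=> I ID I0.
  have bI : b \notin I by apply/negP => /(subsetP ID); rewrite !inE eqxx.
  have Ib : I :\ b = I by apply/setDidPl; rewrite disjoint_sym disjoints1.
  have sD : I \subset D by apply: subset_trans ID (subsetDl _ _).
  have mixE k : k \in mixed_rows (fun k => (h \o f) @: U k)
      (fun k => (h \o f) @: V k) (K :\ j) I =
      (k != j) && (k \in mixed_rows (fun k => f @: U k) (fun k => f @: V k) K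
                   (if a \in I then b |: I else I)).
    by rewrite !inE !img Ib -andbA.
  move: mixE; case: ifP => aI mixE.
    (* If the merged block is in [I], the set pulls back to [b |: I], with one more point and one
       more mixed row, [j], so strictness survives. *)
    have := sp (b |: I); rewrite subUset sub1set bD sD => /(_ isT).
    have -> : b |: I != set0 by apply/set0Pn; exists b; rewrite !inE eqxx.
    rewrite cardsU1 bI /= add1n ltnS (cardsD1 j) => /(_ isT).
    have -> : j \in mixed_rows (fun k => f @: U k) (fun k => f @: V k) K (b |: I).
      by rewrite inE jK Ua Vb !disjoints1 !inE eqxx aI orbT.
    rewrite add1n; congr (_ < _); apply: eq_card => k.
    by rewrite mixE in_setD1.
  apply: leq_ltn_trans (sp I sD I0); apply/subset_leq_card/subsetP => k.
  by rewrite mixE => /andP[].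
- by move: cD; rewrite (cardsD1 b D) bD (cardsD1 j K) jK; lia.
Qed.

Lemma sparse_rows_tree (T J : finType) (U V : J -> {set T}) :
    (forall k, U k != set0 /\ V k != set0) ->
    sparse_rows U V [set: J] [set: T] -> #|T| = #|J|.+1 ->
  gluing_tree U V [set: T] [set: J].
Proof.
move=> ne sp cT.
have [||||L TL] := @sparse_rows_tree_of_blocks T J U V [set: T] [set: J] id ne.
- by move=> i; rewrite inE.
- move=> x _; exists set0.
  have -> : [set i | id i == x] = [set x] by apply/setP => i; rewrite !inE.
  exact: GluingLeaf.
- by move=> I ID I0; rewrite (eq_card (B := mixed_rows U V [set: J] I)) ?sp // => k;
    rewrite !inE !imset_id.
- by rewrite !cardsT.
suff -> : [set: J] = L by [].
(* The rows of a tree are distinct, since no nonempty side fits into two disjoint blocks; counting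
   them shows that [L] exhausts [J]. *)
have cL C K : gluing_tree U V C K -> #|C| = #|K|.+1.
  elim=> [i|C1 C2 K1 K2 j T1 IH1 T2 IH2 dC Uj Vj]; first by rewrite cards1 cards0.
  have sep (W : {set T}) : W \subset C1 -> W \subset C2 -> W != set0 -> False.
    move=> s1 s2 /set0Pn[x xW]; have := disjointFr dC (subsetP s1 _ xW).
    by rewrite (subsetP s2).
  have jK1 : j \notin K1.
    by apply/negP => /(gluing_tree_rows T1)[_ V1]; exact: sep V1 Vj (ne j).2.
  have jK2 : j \notin K2.
    by apply/negP => /(gluing_tree_rows T2)[U2 _]; exact: sep Uj U2 (ne j).1.
  have dK : K1 :&: K2 = set0.
    apply/setP => k; rewrite !inE; apply/negP => /andP[].
    move=> /(gluing_tree_rows T1)[U1 _] /(gluing_tree_rows T2)[U2 _].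
    exact: sep U1 U2 (ne k).1.
  rewrite cardsU (disjoint_setI0 dC) cards0 subn0 cardsU1 inE (negPf jK1) (negPf jK2) /=.
  by rewrite cardsU dK cards0 subn0 IH1 IH2; lia.
apply/esym/eqP; rewrite eqEcard subsetT cardsT /=.
by rewrite -ltnS -cT -(cL _ _ TL) cardsT.
Qed.

End GluingTrees.

(** * Truncated power series and semigroup polynomials *)

Section TruncatedSeries.
Local Open Scope ring_scope.
Implicit Types (A : set nat) (p q r : {poly rat}) (N k d : nat).

(** Congruence modulo [X^N]. Identities of power series are expressed by it, so that only
    polynomials occur. *)
Definition eq_modX N p q := forall k, (k < N)%N -> p`_k = q`_k.

Lemma eq_modX_refl N p : eq_modX N p p. Proof. by []. Qed.

Lemma eq_modX_sym N p q : eq_modX N p q -> eq_modX N q p.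
Proof. by move=> h k /h. Qed.

Lemma eq_modX_trans N q p r : eq_modX N p q -> eq_modX N q r -> eq_modX N p r.
Proof. by move=> h1 h2 k kN; rewrite h1 ?h2. Qed.

Lemma eq_modXM N p q p' q' :
  eq_modX N p q -> eq_modX N p' q' -> eq_modX N (p * p') (q * q').
Proof.
move=> h h' k kN; rewrite !coefM; apply: eq_bigr => j _.
have jk : (j <= k)%N by rewrite -ltnS.
by rewrite h ?h' //; lia.
Qed.

Lemma eq_modXI N r p q : r`_0 != 0 -> eq_modX N (r * p) (r * q) -> eq_modX N p q.
Proof.
move=> r0 h k; elim/ltn_ind: k => k IH kN.
have := h k kN; rewrite !coefM !big_ord_recl subn0 => e.
apply: (mulfI r0); apply: (addIr _ (etrans e _)); congr (_ + _).
by apply: eq_bigr => j _; rewrite lift0 IH //; have := ltn_ord j; lia.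
Qed.

Lemma eq_modX_eq p q : (forall N, eq_modX N p q) -> p = q.
Proof. by move=> h; apply/polyP => k; apply: (h k.+1). Qed.

Lemma coefM1BXn p d k :
  (p * (1 - 'X^d))`_k = p`_k - (if (k < d)%N then 0 else p`_(k - d)).
Proof. by rewrite mulrBr mulr1 coefB coefMXn. Qed.

Lemma coef1BXn d k : (0 < d)%N ->
  (1 - 'X^d : {poly rat})`_k = (k == 0)%:R - (k == d)%:R.
Proof. by rewrite coefB coef1 coefXn. Qed.

Definition indic A k : rat := (`[< A k >])%:R.

Lemma indicT A k : A k -> indic A k = 1.
Proof. by move=> h; rewrite /indic asboolT. Qed.

Lemma indicF A k : ~ A k -> indic A k = 0.
Proof. by move=> h; rewrite /indic asboolF. Qed.

Lemma indic_ge0 A k : 0 <= indic A k. Proof. exact: ler0n. Qed.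

Lemma indic_le1 A k : indic A k <= 1.
Proof. by rewrite /indic; case: asbool. Qed.

Lemma indic_gt0 A k : 0 < indic A k -> A k.
Proof. by rewrite /indic; case: asboolP => // _; rewrite ltxx. Qed.

Lemma eq_indic A k B l : (A k <-> B l) -> indic A k = indic B l.
Proof. by move=> h; rewrite /indic; congr (nat_of_bool _)%:R; apply: asbool_equiv_eq. Qed.

Definition hseries A N : {poly rat} := \poly_(k < N) indic A k.

Lemma coef_hseries A N k : (k < N)%N -> (hseries A N)`_k = indic A k.
Proof. by rewrite coef_poly => ->. Qed.

End TruncatedSeries.

Section SemigroupPoly.
Local Open Scope ring_scope.
Variable S : set nat.
Hypothesis hS : numerical_semigroup S.

Lemma semigroup0 : S 0%N. Proof. by case: hS => -[]. Qed.

Lemma semigroupD x y : S x -> S y -> S (x + y)%N.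
Proof. by case: hS => -[_ +] _; apply. Qed.

Lemma semigroupM x y : S x -> S (y * x)%N.
Proof.
move=> Sx; elim: y => [|y IH]; first by rewrite mul0n; apply: semigroup0.
by rewrite mulSn; apply: semigroupD.
Qed.

Lemma semigroup_cofinite : exists N, forall k, (N <= k)%N -> S k.
Proof.
have [_ /finite_seqP[F eF]] := hS.
exists (\max_(x <- F) x).+1 => k; apply: contraPP => nSk; apply/negP.
rewrite -ltnNge ltnS; apply: leq_bigmax_seq => //.
by have : (~` S)%classic k by []; rewrite eF.
Qed.

Lemma coef_semigroup_poly k : (semigroup_poly S)`_k =
  indic S k - (if k is k'.+1 then indic S k' else 0).
Proof.
have [_ fin] := hS; rewrite /semigroup_poly.
set G := (\sum_(g \in _) _)%R.
have coefG j : G`_j = 1 - indic S j.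
  rewrite /G fsbig_finite //= coef_sum.
  under eq_bigr do rewrite coefXn.
  have [Sj|nSj] := pselect (S j).
    rewrite indicT // subrr big_seq big1 // => g.
    rewrite in_fset_set // => /set_mem /= ng.
    by case: eqP => // e; case: ng; rewrite -e.
  rewrite indicF // subr0.
  have jF : j \in fset_set (~` S)%classic by rewrite in_fset_set //; apply: mem_set.
  rewrite (bigD1_seq j) //= ?eqxx ?big1 ?addr0 //.
    by move=> i ij; rewrite eq_sym (negPf ij).
  exact: fset_uniq.
rewrite coefD coef1 mulrBl mul1r coefB coefXM !coefG.
have S0 : indic S 0 = 1 by apply: indicT semigroup0.
by case: k => [|k] /=; rewrite ?coefG ?S0 ?subrr ?subr0 ?addr0 // add0r; ring.
Qed.

Lemma semigroup_poly_hseries N :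
  eq_modX N (semigroup_poly S) ((1 - 'X) * hseries S N).
Proof.
move=> k kN; rewrite coef_semigroup_poly mulrC -['X]expr1 coefM1BXn.
case: k kN => [|k] kN /=; rewrite ?subn1 ?coef_hseries //.
exact: ltnW.
Qed.

(** Above the degree the coefficients vanish, so membership in [S] is constant from the degree on,
    hence true; the leading coefficient is then nonzero and equal to 0 or 1. *)
Lemma semigroup_poly_monic : semigroup_poly S \is monic.
Proof.
have nz : semigroup_poly S != 0.
  apply/negP => /eqP/polyP/(_ 0%N); rewrite coef_semigroup_poly coef0 subr0.
  by rewrite indicT //; exact: semigroup0.
have [N hN] := semigroup_cofinite.
rewrite monicE lead_coefE; set m := (size _).-1.
have top k : (m < k)%N -> (semigroup_poly S)`_k = 0.
  by move=> mk; apply: nth_default; apply: leq_trans (leqSpred _) mk.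
have up k : indic S (m + k) = indic S m.
  elim: k => [|k IH]; first by rewrite addn0.
  have /top : (m < m + k.+1)%N by rewrite addnS ltnS leq_addr.
  by rewrite addnS coef_semigroup_poly => /subr0_eq ->.
have cm : indic S m = 1.
  by rewrite -(up N) indicT //; apply: hN; apply: leq_addl.
have : (semigroup_poly S)`_m != 0 by rewrite -lead_coefE lead_coef_eq0.
rewrite coef_semigroup_poly cm; case: m {top up cm} => [|m] /=.
  by rewrite subr0.
by rewrite /indic; case: asbool => /=; rewrite ?subrr ?subr0.
Qed.

Lemma semigroup_poly_horner1 : (semigroup_poly S).[1] = 1.
Proof. by rewrite /semigroup_poly -polyC1 hornerD hornerM hornerXsubC hornerC subrr mul0r addr0. Qed.

End SemigroupPoly.

(** * The Hilbert series of a gluing of two monoids *)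

Section GluingSeries.
Local Open Scope ring_scope.

(** All splittings of an element of [T] differ by multiples of [d], so exactly one has its second
    summand in the Apery set [T2'] of [T2] with respect to [d]. The series of [T2'] is that of [T2]
    times [1 - X^d]. *)
Lemma hseries_gluing (T1 T2 T : set nat) (d N : nat) :
    (forall k, T k <-> exists a b, [/\ T1 a, T2 b & k = (a + b)%N]) ->
    (forall a b, T1 a -> T1 b -> T1 (a + b)%N) ->
    (forall a b, T2 a -> T2 b -> T2 (a + b)%N) ->
    (0 < d)%N -> T1 d -> T2 d ->
    (forall a b a' b', T1 a -> T2 b -> T1 a' -> T2 b' -> (a + b = a' + b')%N ->
       a = a' %[mod d]) ->
  eq_modX N (hseries T N) (hseries T1 N * hseries T2 N * (1 - 'X^d)).
Proof.
move=> defT add1 add2 d0 T1d T2d sep k kN.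
pose T2' m := T2 m /\ ~ ((d <= m)%N /\ T2 (m - d)%N).
have coefR m : (m < N)%N -> (hseries T2 N * (1 - 'X^d))`_m = indic T2' m.
  move=> mN; rewrite coefM1BXn coef_hseries //.
  case: ltnP => [md|dm].
    rewrite subr0; apply: eq_indic; split=> [h|[]//]; split=> // -[].
    by rewrite leqNgt md.
  rewrite coef_hseries; last by apply: leq_ltn_trans mN; apply: leq_subr.
  have [h|h] := pselect (T2 (m - d)%N).
    have T2m : T2 m by rewrite -(subnK dm); apply: add2.
    by rewrite (indicT h) (indicT T2m) subrr indicF // => -[_]; apply.
  by rewrite (indicF h) subr0; apply: eq_indic; split=> [T2m|[]//]; split=> // -[_ /h].
rewrite coef_hseries // -mulrA coefM.
transitivity (\sum_(j < k.+1) indic T1 j * indic T2' (k - j)); last first.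
  apply: eq_bigr => j _; have jk : (j <= k)%N by rewrite -ltnS.
  by rewrite coef_hseries ?coefR //; lia.
have [Tk|nTk] := pselect (T k); last first.
  rewrite indicF // big1 // => j _.
  have [T1j|?] := pselect (T1 j); last by rewrite indicF ?mul0r.
  rewrite (@indicF T2') ?mulr0 // => -[T2j _]; apply: nTk; apply/defT.
  by exists j, (k - j)%N; split=> //; rewrite subnKC // -ltnS.
pose P b := `[< T2 b /\ exists2 a, T1 a & k = (a + b)%N >].
have exP : exists b, P b.
  by have [a [b [T1a T2b e]]] := (defT k).1 Tk; exists b; apply/asboolP; split=> //; exists a.
(* The least possible second summand is in the Apery set, as otherwise [d] could be moved to the
   first summand. *)
case: (ex_minnP exP) => b /asboolP[T2b [a T1a ek]] bmin.
have ak : (a < k.+1)%N by rewrite ek ltnS leq_addr.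
have kab : (k - a = b)%N by rewrite ek addKn.
have T2'b : T2' b.
  split=> // -[db T2bd]; have : P (b - d)%N.
    apply/asboolP; split=> //; exists (a + d)%N; first exact: add1.
    by rewrite ek; lia.
  by move=> /bmin; lia.
rewrite indicT // (bigD1 (Ordinal ak)) //= kab (indicT T1a) (indicT T2'b) mul1r.
rewrite big1 ?addr0 // => j ja.
have [T1j|?] := pselect (T1 j); last by rewrite indicF ?mul0r.
rewrite (@indicF T2') ?mulr0 // => -[T2j ndj].
have jk : (j <= k)%N by rewrite -ltnS.
have e : (a + b = j + (k - j))%N by rewrite subnKC // ek.
have ja' : (j <> a :> nat) by move=> ja'; case/eqP: ja; apply: val_inj.
have mod_j := sep _ _ _ _ T1a T2b T1j T2j e.
have addM (X : set nat) x m : (forall a b, X a -> X b -> X (a + b)%N) -> X d ->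
    X x -> X (x + m * d)%N.
  move=> addX Xd Xx; elim: m => [|m IH]; first by rewrite mul0n addn0.
  by rewrite mulSn addnCA; apply: addX.
case: (ltngtP (j : nat) a) => // [lt|lt].
  have /dvdnP[m em] : (d %| a - j)%N by rewrite -eqn_mod_dvd 1?ltnW //; apply/eqP.
  case: m em => [|m]; first by lia.
  rewrite mulSn => em; apply: ndj; split; first by lia.
  have -> : (k - j - d = b + m * d)%N by lia.
  exact: addM.
have /dvdnP[m em] : (d %| j - a)%N by rewrite -eqn_mod_dvd 1?ltnW //; apply/eqP.
have : P (k - j)%N by apply/asboolP; split=> //; exists j => //; rewrite subnKC.
by move/bmin; lia.
Qed.

Lemma hseries_multiples (n N : nat) : (0 < n)%N ->
  eq_modX N (hseries [set s | exists c, s = (c * n)%N]%classic N * (1 - 'X^n)) 1.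
Proof.
move=> n0 k kN; rewrite coefM1BXn coef_hseries // coef1; case: ltnP => [kn|nk].
  rewrite subr0; case: (eqVneq k 0%N) => [->|k0].
    by rewrite indicT //; exists 0%N.
  rewrite indicF // => -[[|c] e]; first by rewrite e eqxx in k0.
  by move: kn; rewrite e mulSn; lia.
rewrite coef_hseries; last by lia.
have -> : (k == 0%N) = false by lia.
apply/eqP; rewrite subr_eq0; apply/eqP; apply: eq_indic; split=> -[c e].
  by case: c e => [|c] e; [lia|exists c; rewrite e mulSn addKn].
by exists c.+1; rewrite mulSn -e subnKC.
Qed.

End GluingSeries.

(** * The Hilbert series of a gluing tree *)

Lemma Posz_sum (I : Type) (r : seq I) (P : pred I) (F : I -> nat) :
  Posz (\sum_(i <- r | P i) F i)%N = (\sum_(i <- r | P i) Posz (F i))%R.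
Proof. exact: (big_morph Posz PoszD). Qed.

Section TreeSeries.
Import fintype boot.finset.

Lemma big_disjointU (R : Type) (idx : R) (op : Monoid.com_law idx)
    (T : finType) (A B : {set T}) (F : T -> R) :
  [disjoint A & B] ->
  \big[op/idx]_(i in A :|: B) F i =
    op (\big[op/idx]_(i in A) F i) (\big[op/idx]_(i in B) F i).
Proof.
by move=> dAB; rewrite -bigU //; apply: eq_bigl => i; rewrite !inE.
Qed.

Local Open Scope ring_scope.
Variables (I J : finType) (n : I -> nat) (u v : J -> {ffun I -> nat}).
Implicit Types (C : {set I}) (K : {set J}) (y : I -> int).

Definition supp (a : {ffun I -> nat}) : {set I} := [set i | (a i != 0)%N].

Definition weight (a : {ffun I -> nat}) : nat := (\sum_i a i * n i)%N.

Definition span C : set nat :=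
  fun s => exists c : I -> nat, s = (\sum_(i in C) c i * n i)%N.

(** Group-level consequence of the rows generating the kernel congruence, in a form that can be
    restricted to a block. *)
Definition lattice_generated C K := forall y,
  (forall i, i \notin C -> y i = 0) -> \sum_i y i * (n i)%:Z = 0 ->
  exists c : J -> int, (forall k, k \notin K -> c k = 0) /\
    forall i, y i = \sum_k c k * ((u k i)%:Z - (v k i)%:Z).

Lemma notin_supp a C i : supp a \subset C -> i \notin C -> a i = 0%N.
Proof.
move=> sC; apply: contraNeq => ai; apply: (subsetP sC).
by rewrite inE.
Qed.

Lemma weight_supp a C : supp a \subset C -> (\sum_(i in C) a i * n i)%N = weight a.
Proof.
move=> sC; rewrite /weight big_mkcond /=; apply: eq_bigr => i _.
by case: ifPn => // /(notin_supp sC) ->.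
Qed.

Lemma weight_supp0 a C1 C2 : [disjoint C1 & C2] -> supp a \subset C2 ->
  (\sum_(i in C1) a i * n i)%N = 0%N.
Proof.
move=> dC s2; rewrite big1 // => i iC1.
by rewrite (notin_supp s2) // (disjointFr dC iC1).
Qed.

Lemma span_weight a C : supp a \subset C -> span C (weight a).
Proof. by move=> sC; exists a; rewrite weight_supp. Qed.

Lemma spanD C s t : span C s -> span C t -> span C (s + t)%N.
Proof.
move=> [c ->] [c' ->]; exists (fun i => c i + c' i)%N.
by rewrite -big_split; apply: eq_bigr => i _; rewrite mulnDl.
Qed.

Lemma spanU C1 C2 k : [disjoint C1 & C2] ->
  span (C1 :|: C2) k <->
  exists a b, [/\ span C1 a, span C2 b & k = (a + b)%N].
Proof.
move=> dC; split=> [[c ->]|[_ [_ [[c1 ->] [c2 ->] ->]]]].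
  exists (\sum_(i in C1) c i * n i)%N, (\sum_(i in C2) c i * n i)%N.
  by split; [exists c|exists c|rewrite -big_disjointU].
exists (fun i => if i \in C1 then c1 i else c2 i).
rewrite big_disjointU //=; congr (_ + _)%N; apply: eq_bigr => i iC; first by rewrite iC.
by rewrite (disjointFl dC iC).
Qed.

Hypothesis n_gt0 : forall i, (0 < n i)%N.
Hypothesis uv_weight : forall k, weight (u k) = weight (v k).
Hypothesis u_neq0 : forall k, supp (u k) != set0.

Lemma weight_gt0 k : (0 < weight (u k))%N.
Proof.
have /set0Pn[i] := u_neq0 k; rewrite inE => ui.
by rewrite /weight (bigD1 i) //= addn_gt0 muln_gt0 lt0n ui n_gt0.
Qed.

Section Node.
Variables (C1 C2 : {set I}) (K1 K2 : {set J}) (j : J).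
Hypothesis dC : [disjoint C1 & C2].
Hypotheses (Uj : supp (u j) \subset C1) (Vj : supp (v j) \subset C2).
Hypothesis row1 : forall k, k \in K1 -> supp (u k) \subset C1 /\ supp (v k) \subset C1.
Hypothesis row2 : forall k, k \in K2 -> supp (u k) \subset C2 /\ supp (v k) \subset C2.
Hypothesis lat : lattice_generated (C1 :|: C2) (j |: (K1 :|: K2)).

(** A common row would have a side supported in both blocks, hence of weight 0. *)
Lemma notin_K1 k : k \in j |: K2 -> k \notin K1.
Proof.
move=> kj; apply/negP => /row1[s1 s1'].
have [W [sW WC1 WC2]] : exists a, [/\ weight a = weight (u k),
    supp a \subset C1 & supp a \subset C2].
  move: kj; rewrite !inE => /orP[/eqP kj|/row2[s2 _]]; last by exists (u k).
  by exists (v k); rewrite s1' kj Vj uv_weight.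
have := weight_gt0 k; rewrite -sW -(weight_supp WC1).
by rewrite (weight_supp0 dC WC2).
Qed.

(** Over [C1] the rows of [K1] are balanced and those of [K2] vanish, so only the row [j]
    contributes. *)
Lemma row_partial_weight (c : J -> int) k :
    (forall k, k \notin j |: (K1 :|: K2) -> c k = 0) ->
  c k * \sum_(i in C1) ((u k i)%:Z - (v k i)%:Z) * (n i)%:Z =
    if k == j then c j * (weight (u j))%:Z else 0.
Proof.
move=> cK.
have -> : \sum_(i in C1) ((u k i)%:Z - (v k i)%:Z) * (n i)%:Z =
    (\sum_(i in C1) u k i * n i)%N%:Z - (\sum_(i in C1) v k i * n i)%N%:Z.
  rewrite !Posz_sum -sumrB; apply: eq_bigr => i _.
  by rewrite mulrBl !PoszM.
case: eqP => [->|/eqP kj].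
  by rewrite (weight_supp Uj) (weight_supp0 dC Vj) subr0.
have [/row1[s1 s1']|k1] := boolP (k \in K1).
  by rewrite !weight_supp // uv_weight subrr mulr0.
have [/row2[s2 s2']|k2] := boolP (k \in K2).
  by rewrite !(weight_supp0 dC) // subrr mulr0.
by rewrite cK ?mul0r // !inE (negPf kj) (negPf k1).
Qed.

Lemma partial_weight y :
    (forall i, i \notin C1 :|: C2 -> y i = 0) -> \sum_i y i * (n i)%:Z = 0 ->
  exists c : J -> int, [/\ forall k, k \notin j |: (K1 :|: K2) -> c k = 0,
    forall i, y i = \sum_k c k * ((u k i)%:Z - (v k i)%:Z) &
    \sum_(i in C1) y i * (n i)%:Z = c j * (weight (u j))%:Z].
Proof.
move=> yC y0; have [c [cK cy]] := lat yC y0; exists c; split=> //.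
under eq_bigr => i _ do rewrite cy mulr_suml.
rewrite exchange_big /=.
under eq_bigr => k _ do (under eq_bigr => i _ do rewrite -mulrA;
  rewrite -mulr_sumr row_partial_weight //).
by rewrite -big_mkcond big_pred1_eq.
Qed.

(** The difference of the two representations is an integer relation, whose part over [C1] is a
    multiple of the weight of [u j] by [partial_weight]. *)
Lemma gluing_sep a b a' b' : span C1 a -> span C2 b -> span C1 a' -> span C2 b' ->
  (a + b = a' + b')%N -> a = a' %[mod weight (u j)].
Proof.
move=> [c1 ea] [c2 eb] [c1' ea'] [c2' eb'] e.
pose y i : int := if i \in C1 then (c1 i)%:Z - (c1' i)%:Z
                  else if i \in C2 then (c2 i)%:Z - (c2' i)%:Z else 0.
have y1 : \sum_(i in C1) y i * (n i)%:Z = a%:Z - a'%:Z.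
  rewrite ea ea' !Posz_sum -sumrB; apply: eq_bigr => i iC.
  by rewrite /y iC mulrBl !PoszM.
have y2 : \sum_(i in C2) y i * (n i)%:Z = b%:Z - b'%:Z.
  rewrite eb eb' !Posz_sum -sumrB; apply: eq_bigr => i iC.
  by rewrite /y iC (disjointFl dC iC) mulrBl !PoszM.
have yC i : i \notin C1 :|: C2 -> y i = 0.
  by rewrite inE negb_or /y => /andP[/negPf-> /negPf->].
have [|c [_ _]] := partial_weight yC.
  rewrite (bigID (mem (C1 :|: C2))) /= [X in _ + X]big1 ?addr0.
    by rewrite big_disjointU //= y1 y2; lia.
  by move=> i /yC ->; rewrite mul0r.
rewrite y1 => h; apply/eqP; rewrite -eqz_nat -!modz_nat eqz_mod_dvd h.
exact: dvdz_mull.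
Qed.

(** A relation supported in one block has weight 0 over [C1], so the row [j] gets coefficient 0, and
    the rows of the other block do not touch [C]. *)
Lemma lattice_generated_sub C K : K \subset K1 :|: K2 ->
    (forall k, k \in K -> supp (u k) \subset C /\ supp (v k) \subset C) ->
    (forall k, k \in (K1 :|: K2) :\: K ->
       [disjoint supp (u k) & C] /\ [disjoint supp (v k) & C]) ->
    (C = C1 \/ C = C2) -> lattice_generated C K.
Proof.
move=> sK inC outC eC y yC y0.
have sC : C \subset C1 :|: C2 by case: eC => ->; [apply: subsetUl|apply: subsetUr].
have [|c [cK cy y1]] := @partial_weight y _ y0.
  by move=> i iC; apply: yC; apply: contra iC; apply: (subsetP sC).
have cj : c j = 0.
  have : c j * (weight (u j))%:Z == 0.
    rewrite -y1; case: eC => eC.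
      rewrite -[X in _ == X]y0 eq_sym (bigID (mem C1)) /= [X in _ + X]big1 ?addr0 //.
      by move=> i iC; rewrite yC ?mul0r // eC.
    by rewrite big1 // => i iC; rewrite yC ?mul0r // eC (disjointFr dC iC).
  by rewrite mulf_eq0 => /orP[/eqP//|]; rewrite eqz_nat -[_ == _]negbK -lt0n weight_gt0.
exists (fun k => if k \in K then c k else 0); split=> [k /negPf-> //|i].
have [iC|iC] := boolP (i \in C); last first.
  rewrite yC // big1 // => k _; case: ifP => [/inC[s s']|_]; last by rewrite mul0r.
  by rewrite (notin_supp s) // (notin_supp s') // subrr mulr0.
rewrite cy; apply: eq_bigr => k _; case: ifPn => // kK; rewrite mul0r.
have [->|kj] := eqVneq k j; first by rewrite cj mul0r.
have [k12|k12] := boolP (k \in K1 :|: K2); last first.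
  by rewrite cK ?mul0r // in_setU1 (negPf kj).
have [|/disjointFl/(_ iC) s /disjointFl/(_ iC) s'] := outC k; first by rewrite inE kK.
move: s s'; rewrite !inE => /negbFE/eqP -> /negbFE/eqP ->.
by rewrite subrr mulr0.
Qed.

End Node.

Lemma disjoint_supp C1 C2 a : [disjoint C1 & C2] -> supp a \subset C2 -> [disjoint supp a & C1].
Proof. by move=> dC s; apply: disjointWl s _; rewrite disjoint_sym. Qed.

(** The lattice condition passes to both children of a node, where [hseries_gluing] applies with [d]
    the weight of [u j]; each node thus yields one factor on the right. *)
Lemma hseries_gluing_tree C K N :
    gluing_tree (fun k => supp (u k)) (fun k => supp (v k)) C K ->
    lattice_generated C K ->
  eq_modX N (hseries (span C) N * \prod_(i in C) (1 - 'X^(n i)))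
            (\prod_(k in K) (1 - 'X^(weight (u k)))).
Proof.
elim=> [i _|C1 C2 K1 K2 j T1 IH1 T2 IH2 dC Uj Vj lat].
  rewrite big_set1 big_set0.
  suff -> : span [set i] = [set s | exists c, s = (c * n i)%N]%classic.
    exact: hseries_multiples.
  apply/seteqP; split=> s [c ->] /=; first by exists (c i); rewrite big_set1.
  by exists (fun=> c); rewrite big_set1.
have row1 k := @gluing_tree_rows _ _ _ _ _ _ k T1.
have row2 k := @gluing_tree_rows _ _ _ _ _ _ k T2.
have dC' : [disjoint C2 & C1] by rewrite disjoint_sym.
have jK1 : j \notin K1.
  by apply: notin_K1 dC Vj row1 row2 _ _; rewrite !inE eqxx.
have dK : [disjoint K1 & K2].
  rewrite disjoint_sym disjoint_subset; apply/subsetP => k kK2; rewrite inE /=.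
  by apply: (notin_K1 dC Vj row1 row2); rewrite !inE kK2 orbT.
have jK2 : j \notin K2.
  apply/negP => /row2[s2 _]; have := weight_gt0 j.
  by rewrite -(weight_supp Uj) (weight_supp0 dC s2).
have lat1 : lattice_generated C1 K1.
  apply: (lattice_generated_sub dC Uj Vj row1 row2 lat) => //; last by left.
    exact: subsetUl.
  move=> k; rewrite !inE => /andP[/negPf->] /= /row2[s2 s2'].
  by split; apply: disjoint_supp (dC) _.
have lat2 : lattice_generated C2 K2.
  apply: (lattice_generated_sub dC Uj Vj row1 row2 lat) => //; last by right.
    exact: subsetUr.
  move=> k; rewrite !inE => /andP[/negPf->]; rewrite orbF => /row1[s2 s2'].
  by split; apply: disjoint_supp (dC') _.
have glue := @hseries_gluing (span C1) (span C2) (span (C1 :|: C2)) (weight (u j)) N.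
have {glue} := glue (fun k => spanU k dC) (@spanD C1) (@spanD C2) (weight_gt0 j).
move=> /(_ (span_weight Uj)); rewrite {1}uv_weight => /(_ (span_weight Vj)).
move=> /(_ (gluing_sep dC Uj Vj row1 row2 lat)) glue.
have jK12 : j \notin K1 :|: K2 by rewrite inE negb_or jK1.
rewrite big_disjointU // big_setU1 //= big_disjointU //=.
apply: eq_modX_trans (eq_modXM glue (eq_modX_refl _)) _.
have := eq_modXM (eq_modX_refl (1 - 'X^(weight (u j))))
  (eq_modXM (IH1 lat1) (IH2 lat2)).
by congr (eq_modX _ _ _); ring.
Qed.

End TreeSeries.

(** * Complete intersections have gluing trees *)

Section SmallestClosed.
Local Open Scope classical_set_scope.
Local Open Scope card_scope.

Lemma submonoid_smallest (G : set nat) : submonoid (smallest submonoid G).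
Proof.
split=> [M [[]]//|x y Sx Sy M [sM GM]].
by case: (sM) => _; apply; [apply: Sx|apply: Sy].
Qed.

Lemma minimal_generator_gt0 (S G : set nat) x :
  minimal_generating_set submonoid S G -> G x -> (0 < x)%N.
Proof.
move=> [gS mS] Gx; rewrite lt0n; apply/negP => /eqP x0.
have sub : G `\ 0%N `<=` G by move=> ? [].
suff eG : G `\ 0%N = G by move: Gx; rewrite -eG x0 => -[_]; apply.
apply: mS => //; apply/seteqP; split.
  by rewrite -gS; apply: sub_smallest2r => //; apply: submonoid_smallest.
rewrite -gS; apply: smallest_sub; first exact: submonoid_smallest.
move=> y Gy; have [->|/eqP y0] := pselect (y = 0%N); first by case: (submonoid_smallest (G `\ 0%N)).
by apply: sub_gen_smallest; split=> // /= e; rewrite e eqxx in y0.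
Qed.

Lemma smallest_submonoid_span (I : finType) (n : I -> nat) :
  smallest submonoid (range n) = span n [set: I]%SET.
Proof.
apply/seteqP; split.
  apply: smallest_sub => [|_ [i _ <-]].
    split=> [|x y]; last exact: spanD.
    by exists (fun=> 0%N); rewrite big1.
  exists (fun k => (k == i)%N : nat).
  rewrite (bigD1 i) ?inE //= eqxx mul1n big1 ?addn0 // => k /andP[_ /negPf->].
  by rewrite mul0n.
move=> _ [c ->]; have [S0 SD] := submonoid_smallest (range n).
elim/big_ind: _ => // i _; elim: (c i) => [|m IH]; first by rewrite mul0n.
by rewrite mulSn; apply: SD => //; apply: sub_gen_smallest; exists i.
Qed.

Lemma card_eq_ord_surj (T : Type) (A : set T) m : A #= `I_m ->
  exists f : 'I_m -> T, A = range f.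
Proof.
move=> /card_set_bijP[g [gf gi gs]].
have /choice[f fP] : forall i : 'I_m, exists x, A x /\ g x = i.
  by move=> i; have [x Ax <-] := gs i (ltn_ord i); exists x.
exists f; apply/seteqP; split=> [x Ax|_ [i _ <-]]; last by case: (fP i).
exists (Ordinal (gf x Ax)) => //; have [Af e] := fP (Ordinal (gf x Ax)).
by apply: gi; [apply: mem_set|apply: mem_set|rewrite e].
Qed.

End SmallestClosed.

(** * Counting the relations that meet a set of generators *)

Section CompleteIntersectionProduct.
Import fintype boot.finset.
Local Open Scope ring_scope.
Variables (e : nat) (n : 'I_e -> nat) (u v : 'I_e.-1 -> {ffun 'I_e -> nat}).
Hypothesis e_gt0 : (0 < e)%N.
Hypothesis n_gt0 : forall i, (0 < n i)%N.
Hypothesis uv_weight : forall k, weight n (u k) = weight n (v k).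
Hypothesis uv_gen : forall R : {ffun 'I_e -> nat} * {ffun 'I_e -> nat} -> Prop,
  congruence R -> (forall k, R (u k, v k)) ->
  forall a b, weight n a = weight n b -> R (a, b).

Lemma suppD (a b : {ffun 'I_e -> nat}) : supp (a + b) = supp a :|: supp b.
Proof. by apply/setP => i; rewrite !inE ffunE /= addn_eq0 negb_and. Qed.

Lemma supp0_weight a : (supp a == set0) = (weight n a == 0%N).
Proof.
apply/eqP/eqP => [s0|/eqP].
  by rewrite -(@weight_supp _ n _ set0) ?s0 // big_set0.
rewrite sum_nat_eq0 => /forallP h; apply/setP => i; rewrite !inE.
by have := h i; rewrite /= muln_eq0 (gtn_eqF (n_gt0 i)) orbF => /eqP->.
Qed.

(* The set [Z] of coordinates that vanish at a 0-1 point of the variety of all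
   the rows; only [Z = set0] and [Z = setT] are compatible with the kernel
   congruence, which identifies a power of each variable with a power of any
   other one. *)
Lemma stable_support (Z : {set 'I_e}) :
    (forall k, [disjoint supp (u k) & Z] = [disjoint supp (v k) & Z]) ->
  Z = set0 \/ Z = setT.
Proof.
move=> st; have [->|Z0] := eqVneq Z set0; first by left.
right; apply/eqP; rewrite -subTset; apply/subsetP => j _.
have [i iZ] := set0Pn _ Z0; apply: contraT => jZ.
pose R (p : {ffun 'I_e -> nat} * {ffun 'I_e -> nat}) :=
  [disjoint supp p.1 & Z] = [disjoint supp p.2 & Z].
have cR : congruence R.
  split; rewrite /R /=; [by []|by move=> x y ->|by move=> x y z -> ->|].
  by move=> x y z; rewrite !suppD -!setI_eq0 !setIUl !setU_eq0 !setI_eq0 => ->.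
have wt (k : 'I_e) m : weight n [ffun l => if l == k then m else 0%N] = (m * n k)%N.
  rewrite /weight (bigD1 k) //= ffunE eqxx big1 ?addn0 // => l /negPf lk.
  by rewrite ffunE lk mul0n.
(* [n j] copies of generator [i] weigh as much as [n i] copies of generator [j], but only the
   support of the former meets [Z]. *)
have := uv_gen cR st (a := [ffun l => if l == i then n j else 0%N])
  (b := [ffun l => if l == j then n i else 0%N]).
rewrite !wt mulnC => /(_ erefl); rewrite /R /=.
have -> : [disjoint supp [ffun l => if l == j then n i else 0%N] & Z].
  rewrite disjoint_subset; apply/subsetP => l; rewrite !inE ffunE.
  by case: (eqVneq l j) => [->|].
move=> /pred0P/(_ i); rewrite /= iZ andbT inE ffunE eqxx.
by rewrite (gtn_eqF (n_gt0 j)).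
Qed.

(** Rows with zero sides are counted too, so that the same argument excludes them. *)
Definition stuck_rows (Z : {set 'I_e}) : {set 'I_e.-1} :=
  [set k | ~~ [disjoint supp (u k) & Z] && ~~ [disjoint supp (v k) & Z]
           || (supp (u k) == set0)].

(** Take a largest violating [Z]. A row meeting it on one side only would allow adding a point of
    the other side and gaining a row. So [stable_support] makes [Z] the whole set, which has more
    points than there are rows. *)
Lemma card_stuck_rows Z : Z != set0 -> (#|stuck_rows Z| < #|Z|)%N.
Proof.
move=> Z0; rewrite ltnNge; apply/negP => cZ.
pose good (Z : {set 'I_e}) := (Z != set0) && (#|Z| <= #|stuck_rows Z|)%N.
have gZ : good Z by apply/andP.
case: (arg_maxnP (fun Z : {set 'I_e} => #|Z|) gZ) => {cZ gZ Z0}Z /andP[Z0 cZ] Zmax.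
have stable k a b : (a = u k /\ b = v k) \/ (a = v k /\ b = u k) ->
    [disjoint supp b & Z] -> [disjoint supp a & Z].
  move=> hab db; apply: contraT => da.
  have wab : weight n a = weight n b by case: hab => -[-> ->]; rewrite uv_weight.
  have ane0 : supp a != set0.
    by apply: contra da => /eqP->; rewrite disjoints_subset sub0set.
  have /set0Pn[y yb] : supp b != set0 by rewrite supp0_weight -wab -supp0_weight.
  have yZ : y \notin Z by rewrite (disjointFr db yb).
  have cyZ : #|y |: Z| = #|Z|.+1 by rewrite cardsU1 yZ.
  have : good (y |: Z).
    apply/andP; split; first by apply/set0Pn; exists y; rewrite !inE eqxx.
    rewrite cyZ; apply: leq_ltn_trans cZ _.
    have dS (c : {ffun 'I_e -> nat}) :
        ~~ [disjoint supp c & Z] -> ~~ [disjoint supp c & y |: Z].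
      by apply: contra; apply: disjointWr; apply: subsetUr.
    have mb : ~~ [disjoint supp b & y |: Z].
      by apply/negP => /disjointFr/(_ yb); rewrite !inE eqxx.
    apply: proper_card; rewrite properE; apply/andP; split.
      apply/subsetP => l; rewrite !inE => /orP[/andP[/dS-> /dS->]//|->].
      by rewrite orbT.
    apply/subsetPn; exists k; rewrite !inE.
      by case: hab => -[ea eb]; rewrite -ea -eb (dS _ da) mb.
    have une0 : supp (u k) != set0.
      by rewrite supp0_weight; case: hab => -[ea eb]; rewrite ?uv_weight -?ea -?eb -?wab -supp0_weight.
    by rewrite (negPf une0) orbF; case: hab => -[ea eb]; rewrite -ea -eb db ?andbF.
  by move=> /Zmax /=; rewrite cyZ ltnn.
have [k|Z0'|ZT] := @stable_support Z; last 2 first.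
- by rewrite Z0' eqxx in Z0.
- have := leq_trans cZ (max_card _); rewrite ZT cardsT !card_ord.
  by case: e e_gt0 => //= m _; rewrite ltnn.
by apply/idP/idP; apply: (stable k); auto.
Qed.

Lemma row_supp_neq0 k : supp (u k) != set0.
Proof.
have e0 : [set Ordinal e_gt0] != set0 :> {set 'I_e}.
  by apply/set0Pn; exists (Ordinal e_gt0); rewrite inE.
have := card_stuck_rows e0; rewrite cards1 ltnS leqn0 cards_eq0 => /eqP s0.
have : k \notin stuck_rows [set Ordinal e_gt0] by rewrite s0 inE.
by rewrite inE negb_or => /andP[].
Qed.

(** Having a difference in the lattice of the rows is a congruence, hence contains the kernel; apply
    this to the positive and negative parts of [y]. *)
Lemma rows_lattice_generated : lattice_generated n u v setT setT.
Proof.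
move=> y _ y0.
pose R (p : {ffun 'I_e -> nat} * {ffun 'I_e -> nat}) :=
  exists c : 'I_e.-1 -> int, forall i,
    (p.1 i)%:Z - (p.2 i)%:Z = \sum_k c k * ((u k i)%:Z - (v k i)%:Z).
have cR : congruence R.
  split=> [a|a b [c h]|a b d [c h] [c' h']|a b d [c h]].
  - by exists (fun=> 0) => i; rewrite subrr big1 // => k _; rewrite mul0r.
  - exists (fun k => - c k) => i; rewrite -opprB h -sumrN.
    by apply: eq_bigr => k _; rewrite mulNr.
  - exists (fun k => c k + c' k) => i.
    have -> : (a i)%:Z - (d i)%:Z = ((a i)%:Z - (b i)%:Z) + ((b i)%:Z - (d i)%:Z).
      by ring.
    rewrite h h' -big_split; apply: eq_bigr => k _; by rewrite mulrDl.
  - exists c => i; rewrite -h /= !ffunE !PoszD; ring.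
have Ruv k : R (u k, v k).
  exists (fun l => (l == k)%:R) => i; rewrite (bigD1 k) //= eqxx mul1r.
  by rewrite big1 ?addr0 // => l /negPf->; rewrite mul0r.
pose a : {ffun 'I_e -> nat} := [ffun i => if 0 <= y i then absz (y i) else 0%N].
pose b : {ffun 'I_e -> nat} := [ffun i => if 0 <= y i then 0%N else absz (y i)].
have yab i : (a i)%:Z - (b i)%:Z = y i by rewrite !ffunE; case: ifP; lia.
have [|c hc] := uv_gen cR Ruv (a := a) (b := b).
  apply/eqP; rewrite -eqz_nat -subr_eq0 !Posz_sum -sumrB -[X in _ == X]y0; apply/eqP.
  by apply: eq_bigr => i _; rewrite !PoszM -mulrBl yab.
exists c; split=> [k|i]; first by rewrite inE.
by rewrite -hc yab.
Qed.

Lemma hseries_complete_intersection N :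
  eq_modX N (hseries (span n setT) N * \prod_i (1 - 'X^(n i)))
            (\prod_k (1 - 'X^(weight n (u k)))).
Proof.
have vne0 k : supp (v k) != set0.
  by rewrite supp0_weight -uv_weight -supp0_weight row_supp_neq0.
have tree : gluing_tree (fun k => supp (u k)) (fun k => supp (v k)) setT setT.
  apply: sparse_rows_tree.
  - by move=> k; rewrite row_supp_neq0 vne0.
  - move=> Z _ Z0; apply: leq_ltn_trans (card_stuck_rows Z0).
    by apply/subset_leq_card/subsetP => k; rewrite !inE => /andP[_ ->].
  - by rewrite !card_ord prednK.
have := hseries_gluing_tree (N := N) n_gt0 uv_weight row_supp_neq0 tree rows_lattice_generated.
by congr (eq_modX _ (_ * _) _); apply: eq_bigl => i; rewrite inE.
Qed.

End CompleteIntersectionProduct.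

Section CompleteIntersectionPoly.
Local Open Scope ring_scope.

(** [ns] lists the minimal generators and [ds] the weights of the relations. *)
Lemma complete_intersection_poly (S : set nat) :
    numerical_semigroup S -> complete_intersection S ->
  exists ns ds : seq nat, all (fun d => 0 < d)%N ds /\
    semigroup_poly S * \prod_(m <- ns) (1 - 'X^m) =
      (1 - 'X) * \prod_(d <- ds) (1 - 'X^d).
Proof.
move=> hS [e [n [rho [_ minS [genR _] cardR]]]].
have eS : S = span n [set: 'I_e]%SET by rewrite -smallest_submonoid_span; case: minS.
have n_gt0 i : (0 < n i)%N by apply: minimal_generator_gt0 minS _; exists i.
have e_gt0 : (0 < e)%N.
  rewrite lt0n; apply/negP => /eqP e0.
  have [N /(_ N.+1 (leqnSn N))] := semigroup_cofinite hS.
  rewrite eS => -[c]; rewrite big1 // => i _.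
  by move: (ltn_ord i); rewrite [X in (_ < X)%N]e0.
have [f rhoE] := card_eq_ord_surj cardR.
have Sf k : weight n (f k).1 = weight n (f k).2.
  have : rho (f k) by rewrite rhoE; exists k.
  by move=> /(@sub_gen_smallest _ (@congruence _) rho); rewrite genR.
have gen R : congruence R -> (forall k, R ((f k).1, (f k).2)) ->
    forall a b, weight n a = weight n b -> R (a, b).
  move=> cR Rf a b wab.
  have : kernel_congruence n (a, b) by [].
  rewrite -genR; apply; split=> // p; rewrite rhoE => -[k _ <-].
  by have := Rf k; case: (f k).
have ser := hseries_complete_intersection e_gt0 n_gt0 Sf gen.
exists [seq n i | i <- index_enum 'I_e], [seq weight n (f k).1 | k <- index_enum 'I_e.-1].
split.
  apply/allP => _ /mapP[k _ ->].
  exact: (weight_gt0 n_gt0 (row_supp_neq0 e_gt0 n_gt0 Sf gen)).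
rewrite !big_map; apply: eq_modX_eq => N.
apply: eq_modX_trans (eq_modXM (semigroup_poly_hseries hS (N := N)) (@eq_modX_refl N _)) _.
rewrite -mulrA; apply: eq_modXM (eq_modX_refl _) _.
by have := ser N; rewrite -eS.
Qed.

End CompleteIntersectionPoly.

(** * Factorizations into cyclotomic polynomials *)

Section Factorizations.
Local Open Scope ring_scope.
Variable F : fieldType.
Implicit Types p q : {poly F}.

Lemma irreducible_dvd_or_coprime p q :
  irreducible_poly p -> (p %| q) || coprimep p q.
Proof.
move=> [_ irr]; have [_|ngcd] := boolP (coprimep p q); first by rewrite orbT.
by rewrite orbF -(eqp_dvdl _ (irr _ ngcd (dvdp_gcdl p q))) dvdp_gcdr.
Qed.

Lemma irreducible_dvd_prod p (s : seq {poly F}) :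
  irreducible_poly p -> p %| \prod_(q <- s) q -> exists2 q, q \in s & p %| q.
Proof.
move=> irr; elim: s => [|q s IH].
  by rewrite big_nil dvdp1; case: irr => /ltn_eqF; rewrite eq_sym => ->.
rewrite big_cons; case/orP: (irreducible_dvd_or_coprime q irr) => [pq _|cpq].
  by exists q; rewrite ?mem_head.
rewrite Gauss_dvdpr // => /IH[r rs pr]; exists r => //.
by rewrite in_cons rs orbT.
Qed.

(** An irreducible [p] divides some [q] in [r], with quotient [c]. Cancel [p] and induct, with [q]
    replaced by [c], or dropped when [c] is constant. *)
Lemma size_nonconstant_factors (s : seq {poly F}) :
    (forall p, p \in s -> irreducible_poly p) ->
  forall r, (forall p, p \in r -> (1 < size p)%N) ->
    \prod_(p <- r) p %= \prod_(p <- s) p -> (size r <= size s)%N.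
Proof.
elim: s => [|p s IH] irr r nc.
  rewrite big_nil; case: r nc => // q r nc; rewrite big_cons => e.
  have : q %| 1 by rewrite -(eqp_dvdr _ e) dvdp_mulr.
  by rewrite dvdp1 => /eqP e1; have := nc q (mem_head _ _); rewrite e1.
have irrp := irr p (mem_head _ _).
have p0 : p != 0 by rewrite -size_poly_gt0; case: irrp => /ltnW.
have irrs q : q \in s -> irreducible_poly q.
  by move=> qs; apply: irr; rewrite in_cons qs orbT.
rewrite big_cons => e; have : p %| \prod_(q <- r) q by rewrite (eqp_dvdr _ e) dvdp_mulr.
case/(irreducible_dvd_prod irrp) => q qr /dvdpP[c eq].
have rest (x : {poly F}) : x \in rem q r -> (1 < size x)%N by move/mem_rem/nc.
have e' : c * \prod_(x <- rem q r) x %= \prod_(x <- s) x.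
  rewrite -(eqp_mul2l _ _ p0) mulrA [p * c]mulrC -eq.
  by move: e; rewrite (big_rem q qr).
rewrite /= -(size_map id) (perm_size (_ : perm_eq _ (q :: rem q r))) ?map_id ?perm_to_rem //=.
rewrite ltnS; have [c1|c1] := leqP (size c) 1; last first.
  apply: ltnW; apply: (IH irrs (c :: rem q r)); last by rewrite big_cons.
  by move=> x; rewrite in_cons => /orP[/eqP->|/rest].
apply: IH => //; apply: eqp_trans e'; rewrite eqp_sym.
have c0 : c != 0.
  apply: contraTneq (nc q qr) => c0.
  by rewrite eq c0 mul0r size_poly0.
rewrite -{2}[\prod_(x <- _) x]mul1r; apply: eqp_mulr.
rewrite -size_poly_eq1 eqn_leq c1 size_poly_gt0 //.
Qed.

End Factorizations.

Section Cyclotomic.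
Local Open Scope ring_scope.

(* Locked, as unification may otherwise try to compute ['Phi_n]. *)
Definition phi (n : nat) : {poly rat} := locked (map_poly intr 'Phi_n).

Lemma phiE n : phi n = map_poly intr 'Phi_n.
Proof. by rewrite /phi -lock. Qed.

Lemma phi_monic n : phi n \is monic.
Proof. by rewrite phiE; exact/monic_map/Cyclotomic_monic. Qed.

Lemma phi_neq0 n : phi n != 0.
Proof. exact/monic_neq0/phi_monic. Qed.

Lemma size_phi n : size (phi n) = (totient n).+1.
Proof. by rewrite phiE size_map_inj_poly ?size_Cyclotomic //; apply: intr_inj. Qed.

Lemma prod_phi n : (0 < n)%N -> \prod_(d <- divisors n) phi d = 'X^n - 1.
Proof.
move=> n0; under eq_bigr do rewrite phiE.
rewrite -(@rmorph_prod _ _ (map_poly intr)) /= prod_Cyclotomic //.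
by rewrite rmorphB rmorph1 /= map_polyXn.
Qed.

(** [phi n] is the minimal polynomial of a primitive root [z]. In a factorization some factor
    vanishes at [z], hence is a multiple of [phi n], and by degree the other is constant. *)
Lemma phi_irreducible n : (0 < n)%N -> irreducible_poly (phi n).
Proof.
move=> n0; have [z pz] := C_prim_root_exists n0.
have [p [ep mp] pP] := minCpolyP z.
have e : phi n = p.
  apply: (map_inj_poly (@fmorph_inj _ _ (@ratr algC))); first exact: rmorph0.
  rewrite phiE -ep (minCpoly_cyclotomic pz) -(Cintr_Cyclotomic pz) -map_poly_comp.
  by apply: eq_map_poly => a /=; rewrite rmorph_int.
split; first by rewrite size_phi ltnS totient_gt0.
move=> q q1 /dvdpP[r er].
have rz : root (map_poly ratr r) z || root (map_poly ratr q) z.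
  by rewrite -rootM -rmorphM /= -er pP e.
have q0 : q != 0 by apply: contraNneq (phi_neq0 n) => q0; rewrite er q0 mulr0.
have r0 : r != 0 by apply: contraNneq (phi_neq0 n) => r0; rewrite er r0 mul0r.
case/orP: rz; rewrite pP -e => dv; last by rewrite /eqp dv er dvdp_mull.
have := dvdp_leq r0 dv; rewrite er size_mul //.
have : (1 < size q)%N by rewrite ltn_neqAle eq_sym q1 size_poly_gt0.
have := size_poly_gt0 r; rewrite r0.
case: (size r) (size q) => // a [|[|b]] // _ _.
by rewrite !addSn !addnS /= ltnS ltnNge leq_addr.
Qed.

Lemma prod_1BXn (ds : seq nat) : all (fun d => 0 < d)%N ds ->
  exists2 s, all (fun n => 0 < n)%N s &
    \prod_(d <- ds) (1 - 'X^d) %= \prod_(n <- s) phi n.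
Proof.
elim: ds => [_|d ds IH /= /andP[d0 /IH[s s0 e]]].
  by exists [::] => //; rewrite !big_nil eqpxx.
exists (divisors d ++ s).
  rewrite all_cat s0 andbT; apply/allP => k.
  by rewrite -dvdn_divisors // => /(dvdn_gt0 d0).
rewrite big_cons big_cat /= prod_phi // -opprB mulNr.
by apply: eqp_trans (eqp_mull _ e); rewrite -scaleN1r eqp_scale ?oppr_eq0 ?oner_eq0.
Qed.

Lemma monic_dvd_prod_phi p (s : seq nat) :
    all (fun n => 0 < n)%N s -> p \is monic -> p %| \prod_(n <- s) phi n ->
  exists2 r, all (fun n => 0 < n)%N r & p = \prod_(n <- r) phi n.
Proof.
elim: s p => [|n s IH] p /=.
  move=> _ mp; rewrite big_nil dvdp1 => /eqP sp1.
  have e := size1_polyC (eq_leq sp1).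
  exists [::] => //; rewrite big_nil.
  by move: mp; rewrite e monicE lead_coefC => /eqP->.
move=> /andP[n0 s0] mp; rewrite big_cons.
case/orP: (irreducible_dvd_or_coprime p (phi_irreducible n0)) => [|cp].
  case/dvdpP => q eq; rewrite eq mulrC dvdp_mul2l ?phi_neq0 // => dq.
  have mq : q \is monic by move: mp; rewrite eq monicMr ?phi_monic.
  have [r r0 er] := IH q s0 mq dq.
  by exists (n :: r); rewrite /= ?n0 // big_cons -er mulrC.
by rewrite Gauss_dvdpr 1?coprimep_sym // => /(IH p s0 mp).
Qed.

Lemma complete_intersection_cyclotomic (S : set nat) :
  numerical_semigroup S -> complete_intersection S -> cyclotomic_semigroup S.
Proof.
move=> hS /(complete_intersection_poly hS)[ns [ds [ds0 e]]].
(* The extra entry 1 accounts for the factor [1 - X]. *)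
have [s s0 es] := @prod_1BXn (1%N :: ds) ds0.
have [|r r0 er] := monic_dvd_prod_phi s0 (semigroup_poly_monic hS).
  by rewrite -(eqp_dvdr _ es) big_cons expr1 -e dvdp_mulr.
by exists r; rewrite // er; apply: eq_bigr => n _; rewrite phiE.
Qed.

End Cyclotomic.

(** * Identities between cyclotomic polynomials *)

Section CyclotomicIdentities.
Local Open Scope ring_scope.

(** The value of [phi n] at [X^l] for a prime [l], see [phi_comp_Xn]. *)
Definition phi_cofactor l n : {poly rat} :=
  if (l %| n)%N then phi (n * l) else phi (n * l) * phi n.

(** The divisors of [n * l] are the [d * l] with [d] dividing [n], and the divisors of [n] prime to
    [l]. *)
Lemma prod_phi_cofactor l n : prime l -> (0 < n)%N ->
  \prod_(d <- divisors n) phi_cofactor l d = \prod_(d <- divisors (n * l)) phi d.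
Proof.
move=> pl n0; have l0 := prime_gt0 pl; have nl0 : (0 < n * l)%N by rewrite muln_gt0 n0.
have -> : \prod_(d <- divisors n) phi_cofactor l d =
    \prod_(d <- divisors n) phi (d * l) * \prod_(d <- divisors n | ~~ (l %| d)%N) phi d.
  rewrite [X in _ * X]big_mkcond -big_split; apply: eq_bigr => d _ /=.
  by rewrite /phi_cofactor; case: (l %| d)%N => /=; rewrite ?mulr1.
rewrite [RHS](bigID (fun d => l %| d)%N) /=; congr (_ * _).
  rewrite -(big_map (fun d => d * l)%N xpredT phi) -[RHS]big_filter.
  apply/perm_big/uniq_perm.
  - by rewrite map_inj_uniq ?divisors_uniq // => x y /eqP; rewrite eqn_pmul2r // => /eqP.
  - exact/filter_uniq/divisors_uniq.
  move=> d; rewrite mem_filter -dvdn_divisors //; apply/mapP/andP.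
    by case=> k; rewrite -dvdn_divisors // => kn ->; rewrite dvdn_mull ?dvdn_pmul2r.
  case=> /dvdnP[k ->]; rewrite dvdn_pmul2r // => kn.
  by exists k => //; rewrite -dvdn_divisors.
rewrite -[LHS]big_filter -[RHS]big_filter.
apply/perm_big/uniq_perm; try exact/filter_uniq/divisors_uniq.
move=> d; rewrite !mem_filter -!dvdn_divisors //.
have [//|ld] := boolP (l %| d)%N; rewrite /= Gauss_dvdl //.
by rewrite coprime_sym prime_coprime.
Qed.

(** The products of both sides over the divisors of [n] equal [X^(n l) - 1]; by strong induction the
    proper divisors cancel. *)
Lemma phi_comp_Xn l n : prime l -> (0 < n)%N -> phi n \Po 'X^l = phi_cofactor l n.
Proof.
move=> pl; elim/ltn_ind: n => n IH n0.
have : \prod_(d <- divisors n) (phi d \Po 'X^l) =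
       \prod_(d <- divisors n) phi_cofactor l d.
  rewrite prod_phi_cofactor // prod_phi ?muln_gt0 ?n0 ?prime_gt0 //.
  rewrite -(rmorph_prod (comp_poly 'X^l)) prod_phi //= rmorphB rmorph1 /=.
  by rewrite comp_Xn_poly -exprM mulnC.
have nd : n \in divisors n by rewrite -dvdn_divisors.
rewrite !(big_rem n nd) /= => e.
have e' : \prod_(d <- rem n (divisors n)) (phi d \Po 'X^l) =
    \prod_(d <- rem n (divisors n)) phi_cofactor l d.
  apply: eq_big_seq => d; rewrite mem_rem_uniq ?divisors_uniq // inE.
  rewrite -dvdn_divisors // => /andP[dn dvd]; apply: IH; last exact: dvdn_gt0 dvd.
  by rewrite ltn_neqAle dn dvdn_leq.
move: e; rewrite e' => /mulIf; apply.
rewrite prodf_seq_neq0; apply/allP => d _; rewrite /phi_cofactor.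
by case: ifP => _; rewrite ?mulf_neq0 ?phi_neq0.
Qed.

Lemma phi1 : phi 1 = 'X - 1.
Proof. by have := @prod_phi 1 isT; rewrite big_seq1 expr1. Qed.

(** Evaluate the factorization of [X^n - 1] at 0: [phi 1] gives -1, and by induction the other
    proper divisors give 1. *)
Lemma phi_coef0 n : (1 < n)%N -> (phi n)`_0 = 1.
Proof.
elim/ltn_ind: n => n IH n1; have n0 := ltnW n1.
have : (\prod_(d <- divisors n) phi d).[0] = -1.
  by rewrite prod_phi // !hornerE expr0n gtn_eqF // sub0r.
have nd : n \in divisors n by rewrite -dvdn_divisors.
have d1 : 1%N \in rem n (divisors n).
  by rewrite mem_rem_uniq ?divisors_uniq // inE -dvdn_divisors ?dvd1n // neq_ltn n1.
rewrite horner_prod (big_rem n nd) /= (big_rem 1%N d1) /= phi1 big_seq big1.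
  by rewrite -horner_coef0 !hornerE /= ?mulr1 mulrN1 => /oppr_inj.
move=> d; rewrite mem_rem_uniq ?rem_uniq ?divisors_uniq // inE => /andP[d1'].
rewrite mem_rem_uniq ?divisors_uniq // inE -dvdn_divisors // => /andP[dn dvd].
rewrite horner_coef0; apply: IH; first by rewrite ltn_neqAle dn dvdn_leq.
by rewrite ltn_neqAle eq_sym d1' (dvdn_gt0 n0).
Qed.

Lemma coef_comp_Xn (p : {poly rat}) l k : (0 < l)%N ->
  (p \Po 'X^l)`_k = if (l %| k)%N then p`_(k %/ l) else 0.
Proof. exact: coef_comp_poly_Xn. Qed.

Lemma phi_prime l : prime l -> phi l * ('X - 1) = 'X^l - 1.
Proof.
move=> pl; have := @phi_comp_Xn l 1 pl isT.
rewrite /phi_cofactor dvdn1 gtn_eqF ?prime_gt1 // mul1n phi1 => <-.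
by rewrite rmorphB rmorph1 /= comp_polyX.
Qed.

Lemma phi_pq p q : prime p -> prime q -> p != q ->
  phi (p * q) * (1 - 'X^p) * (1 - 'X^q) = (1 - 'X) * (1 - 'X^(p * q)).
Proof.
move=> pp pq npq; have := @phi_comp_Xn q p pq (prime_gt0 pp).
rewrite /phi_cofactor dvdn_prime2 // eq_sym (negPf npq) => e.
have X1 : 'X - 1 != 0 :> {poly rat} by rewrite -[1]/(1%:P) polyXsubC_eq0.
have := congr1 (fun r => r \Po 'X^q) (phi_prime pp).
rewrite rmorphM /= e !rmorphB !rmorph1 /= comp_polyX comp_Xn_poly -exprM [(q * p)%N]mulnC => e1.
have e2 := phi_prime pp.
have -> : 1 - 'X^(p * q) = - ('X^(p * q) - 1) :> {poly rat} by rewrite opprB.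
have -> : 1 - 'X^p = - ('X^p - 1) :> {poly rat} by rewrite opprB.
by rewrite -e1 -e2; ring.
Qed.

Lemma phi_coef1_prime l : prime l -> (phi l)`_1 = 1.
Proof.
move=> pl; have := congr1 (fun p : {poly rat} => p`_1) (phi_prime pl).
rewrite mulrBr mulr1 coefB coefMX coefB coefXn coef1 /= phi_coef0 ?prime_gt1 //.
by rewrite eq_sym gtn_eqF ?prime_gt1 // subr0 => /subr0_eq.
Qed.

(** The product of [phi (n * l)] and [phi n] is a polynomial in [X^l], so it has no term of degree
    1. *)
Lemma phi_coef1M l n : prime l -> (1 < n)%N -> ~~ (l %| n)%N ->
  (phi (n * l))`_1 = - (phi n)`_1.
Proof.
move=> pl n1 ln; have := @phi_comp_Xn l n pl (ltnW n1).
rewrite /phi_cofactor (negPf ln) => /(congr1 (fun p : {poly rat} => p`_1)).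
rewrite coef_comp_Xn ?prime_gt0 // dvdn1 gtn_eqF ?prime_gt1 // coefM.
rewrite !big_ord_recl big_ord0 /= !phi_coef0 //; first by lra.
by apply: leq_trans n1 _; rewrite leq_pmulr ?prime_gt0.
Qed.

Definition primes_prod (s : seq nat) : nat := (\prod_(l <- s) l)%N.

Lemma primes_prod_gt0 s : all prime s -> (0 < primes_prod s)%N.
Proof.
move=> ps; rewrite /primes_prod big_seq; apply: prodn_cond_gt0 => l ls.
exact/prime_gt0/(allP ps).
Qed.

Lemma prime_dvd_primes_prod l s : prime l -> all prime s ->
  (l %| primes_prod s)%N = (l \in s).
Proof.
move=> pl; elim: s => [_|a s IH /= /andP[pa ps]].
  by rewrite /primes_prod big_nil dvdn1 gtn_eqF ?prime_gt1.
by rewrite /primes_prod big_cons Euclid_dvdM // IH // dvdn_prime2 // in_cons.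
Qed.

Lemma phi_coef1_primes l s : prime l -> all prime s -> uniq (l :: s) ->
  (phi (primes_prod (l :: s)))`_1 = (-1) ^+ size s.
Proof.
move=> pl ps /= /andP[ls us]; elim/last_ind: s ps ls us => [|s a IH].
  by rewrite /primes_prod big_seq1 phi_coef1_prime.
rewrite all_rcons rcons_uniq mem_rcons in_cons negb_or size_rcons.
move=> /andP[pa ps] /andP[la ls] /andP[nas us].
have eM : primes_prod (l :: rcons s a) = (primes_prod (l :: s) * a)%N.
  by rewrite /primes_prod !big_cons -cats1 big_cat big_seq1 mulnA.
have pls : all prime (l :: s) by rewrite /= pl.
rewrite eM phi_coef1M ?IH ?exprS ?mulN1r //.
  rewrite /primes_prod big_cons; apply: leq_trans (prime_gt1 pl) _.
  by rewrite leq_pmulr // primes_prod_gt0.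
by rewrite prime_dvd_primes_prod // in_cons negb_or nas eq_sym la.
Qed.

(* Multiplying [n] by a prime [l >= N] inverts [phi n] modulo ['X^N]. *)
Lemma phi_primes_modX N n s : (1 < n)%N -> all prime s -> uniq s ->
    (forall l, l \in s -> (N <= l)%N /\ ~~ (l %| n)%N) ->
  eq_modX N (if odd (size s) then phi (n * primes_prod s) * phi n
             else phi (n * primes_prod s))
            (if odd (size s) then 1 else phi n).
Proof.
elim: s n => [|l s IH] n n1; first by rewrite /primes_prod big_nil muln1.
move=> /= /andP[pl ps] /andP[ls us] hs.
have [Nl ln] := hs l (mem_head _ _).
have nl1 : (1 < n * l)%N.
  by apply: leq_trans n1 _; rewrite leq_pmulr ?prime_gt0.
have cond a : a \in s -> (N <= a)%N /\ ~~ (a %| n * l)%N.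
  move=> als; have [|Na an] := hs a; first by rewrite in_cons als orbT.
  have pa : prime a by apply: (allP ps).
  rewrite Euclid_dvdM // negb_or an dvdn_prime2 //; split=> //.
  by apply: contra ls => /eqP <-.
have nl : eq_modX N (phi (n * l) * phi n) 1.
  have := @phi_comp_Xn l n pl (ltnW n1); rewrite /phi_cofactor (negPf ln) => <-.
  move=> k kN; rewrite coef_comp_Xn ?prime_gt0 // coef1.
  have kl := leq_trans kN Nl; case: (posnP k) => [->|k0].
    by rewrite dvdn0 div0n phi_coef0.
  by rewrite gtnNdvd // gtn_eqF.
have -> : (n * primes_prod (l :: s) = n * l * primes_prod s)%N.
  by rewrite /primes_prod big_cons mulnA.
have := IH (n * l)%N nl1 ps us cond.
case: (odd (size s)) => /= h.
  apply: eq_modX_trans (_ : eq_modX N _ (phi (n * l * primes_prod s) * (phi (n * l) * phi n))) _.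
    rewrite -{1}[phi (n * l * _)]mulr1.
    by apply: eq_modXM (@eq_modX_refl _ _) _; apply: eq_modX_sym.
  by rewrite mulrA -{2}[phi n]mul1r; apply: eq_modXM h (@eq_modX_refl _ _).
exact: eq_modX_trans (eq_modXM h (@eq_modX_refl _ _)) nl.
Qed.

End CyclotomicIdentities.

(** * Elements of a semigroup read off its polynomial *)

(** Sylvester's bound for the Frobenius number of two coprime integers. *)
Lemma coprime_combination a b k : (0 < a)%N -> (0 < b)%N -> coprime a b ->
  (a.-1 * b.-1 <= k)%N -> exists x y, k = (x * a + y * b)%N.
Proof.
move=> a0 b0 cab kge; pose m := chinese a b k 0.
have ma : m = k %[mod a] by apply: chinese_modl.
have /dvdnP[y' my] : (b %| m)%N by rewrite /dvdn chinese_modr ?mod0n.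
pose y := (y' %% a)%N.
have ya : (y * b = k %[mod a])%N by rewrite -ma my modnMml.
have ylt : (y < a)%N by apply: ltn_pmod.
have yb : (y * b <= a.-1 * b)%N by rewrite leq_mul2r -ltnS prednK ?ylt ?orbT.
have [yk|ky] := leqP (y * b) k.
  have /dvdnP[x ex] : (a %| k - y * b)%N by rewrite -eqn_mod_dvd // eq_sym; apply/eqP.
  by exists x, y; rewrite -ex subnK.
(* Otherwise [k] falls short of [y * b], which is at most [(a - 1) b], by a positive multiple of
   [a], and so lies below [(a - 1)(b - 1)]. *)
have : (a <= y * b - k)%N.
  by apply: dvdn_leq; rewrite ?subn_gt0 // -eqn_mod_dvd 1?ltnW //; apply/eqP.
move=> aybk; exfalso; move: (y * b)%N a0 b0 yb ky aybk kge; clear.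
by case: a b => // a [|b] //= z _ _; lia.
Qed.

Section SemigroupElements.
Local Open Scope ring_scope.
Variable S : set nat.
Hypothesis hS : numerical_semigroup S.

Lemma size_semigroup_poly a b : (0 < a)%N -> (0 < b)%N -> coprime a b ->
  S a -> S b -> (size (semigroup_poly S) <= (a.-1 * b.-1).+1)%N.
Proof.
move=> a0 b0 cab Sa Sb.
have big k : (a.-1 * b.-1 <= k)%N -> S k.
  move=> /(coprime_combination a0 b0 cab)[x [y ->]].
  by apply: (semigroupD hS); apply: (semigroupM hS).
apply/leq_sizeP => -[//|k] /[1!ltnS] kge; rewrite coef_semigroup_poly //.
by rewrite !indicT ?subrr //; apply: big; rewrite // leqW.
Qed.

Lemma semigroup_poly1 : semigroup_poly S = 1 -> forall k, S k.
Proof.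
move=> e; elim=> [|k IH]; first exact: semigroup0.
apply: indic_gt0; have := congr1 (fun p : {poly rat} => p`_k.+1) e.
by rewrite coef_semigroup_poly // coef1 (indicT IH) /= => /subr0_eq ->.
Qed.

Lemma semigroup_poly_coef1 : ~ S 1%N -> (semigroup_poly S)`_1 = -1.
Proof.
by move=> nS1; rewrite coef_semigroup_poly // indicF // indicT ?sub0r //; apply: semigroup0.
Qed.

Lemma semigroup1 : S 1%N -> forall k, S k.
Proof. by move=> S1 k; rewrite -[k]muln1; apply: semigroupM. Qed.

(** Cancelling [1 - X] turns partial knowledge of one factor of the semigroup polynomial into
    information on the Hilbert series. *)
Lemma hseries_factor N (q R : {poly rat}) :
    semigroup_poly S = q * R -> forall c c' : {poly rat},
    eq_modX N (q * c) ((1 - 'X) * c') ->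
  eq_modX N (hseries S N * c) (R * c').
Proof.
move=> e c c' h; apply: (@eq_modXI _ (1 - 'X)).
  by rewrite coefB coef1 coefX.
have := eq_modXM (semigroup_poly_hseries hS (N := N)) (@eq_modX_refl N c).
rewrite e => h1; rewrite mulrA.
apply: eq_modX_trans (eq_modX_sym h1) _.
have := eq_modXM (@eq_modX_refl N R) h.
by congr (eq_modX _ _ _); ring.
Qed.


(** Here [f] imitates [phi (p * q)] up to degree [q], where the Hilbert series times
    [(1 - X^p)(1 - X^q)] thus agrees with [R]. This gives a recursion for membership. *)
Lemma indic_below_pq p q (f R : {poly rat}) : (0 < p)%N -> (p < q)%N ->
    semigroup_poly S = f * R ->
    eq_modX q.+1 (f * ((1 - 'X^p) * (1 - 'X^q))) (1 - 'X) ->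
  forall k, (k <= q)%N -> indic S k =
    (if (k < p)%N then 0 else indic S (k - p)) + (k == q)%:R + R`_k.
Proof.
move=> p0 pq e h k kq.
have h1 : eq_modX q.+1 (f * ((1 - 'X^p) * (1 - 'X^q))) ((1 - 'X) * 1) by rewrite mulr1.
have := hseries_factor e h1; rewrite mulr1 mulrA => /(_ k); rewrite ltnS => /(_ kq) <-.
rewrite coefM1BXn coefM1BXn coef_hseries ?ltnS //.
have -> : (if (k < p)%N then 0 else (hseries S q.+1)`_(k - p)) =
          (if (k < p)%N then 0 else indic S (k - p)).
  by case: ifP => // _; rewrite coef_hseries // ltnS; lia.
have -> : (if (k < q)%N then 0 else (hseries S q.+1 * (1 - 'X^p))`_(k - q)) =
          (k == q)%:R.
  case: ltngtP kq => // -> _; rewrite subnn coefM1BXn p0 subr0 coef_hseries //.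
  by rewrite indicT //; apply: semigroup0.
ring.
Qed.

End SemigroupElements.

Section QuotientSeries.
Local Open Scope ring_scope.
Variables (t b : nat).
Hypotheses (t_gt0 : (0 < t)%N) (tb : coprime t b).

(** Dividing [1 - X^(t b)] by [1 - X^b] gives the sum of the [X^(b j)] for [j < t]; dividing [Psi]
    by [1 - X] gives its partial sums. *)
Lemma coef_gluing_series N (h Psi : {poly rat}) :
    eq_modX N (h * ((1 - 'X^b) * (1 - 'X^t))) ((1 - 'X^(t * b)) * (Psi \Po 'X^t)) ->
    (0 < b)%N ->
  forall k, (k < N)%N -> h`_k = \sum_(j < t)
    if (b * j <= k)%N && (t %| k - b * j)%N
    then \sum_(i < ((k - b * j) %/ t).+1) Psi`_i else 0.
Proof.
move=> e b0.
pose A : {poly rat} := \sum_(j < t) 'X^(b * j).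
have eA : A * (1 - 'X^b) = 1 - 'X^(t * b).
  have -> : A = \sum_(j < t) ('X^b) ^+ j by apply: eq_bigr => j _; rewrite exprM.
  by rewrite -[RHS]opprB mulnC exprM subrX1; ring.
pose G : {poly rat} := \poly_(i < N) \sum_(j < i.+1) Psi`_j.
have eG : eq_modX N ((G \Po 'X^t) * (1 - 'X^t)) (Psi \Po 'X^t).
  have -> : (G \Po 'X^t) * (1 - 'X^t) = (G * (1 - 'X)) \Po 'X^t.
    by rewrite rmorphM rmorphB rmorph1 /= comp_polyX.
  move=> k kN; rewrite !coef_comp_Xn //; case: ifP => // _.
  have : (k %/ t < N)%N by apply: leq_ltn_trans (leq_div _ _) kN.
  move: (k %/ t)%N => {kN}k kN; rewrite -['X]expr1 coefM1BXn coef_poly kN.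
  case: k kN => [|k] kN; first by rewrite big_ord1 subr0.
  by rewrite subn1 /= coef_poly (ltnW kN) [X in X - _]big_ord_recr /= addrAC subrr add0r.
have : eq_modX N h (A * (G \Po 'X^t)).
  apply: (@eq_modXI _ ((1 - 'X^b) * (1 - 'X^t))).
    by rewrite coefM1BXn t_gt0 coefB coef1 coefXn (ltn_eqF b0).
  rewrite mulrC; apply: eq_modX_trans e _; rewrite -eA.
  have := eq_modXM (@eq_modX_refl N (A * (1 - 'X^b))) (eq_modX_sym eG).
  by congr (eq_modX _ _ _); ring.
move=> hA k kN; rewrite (hA k kN) /A mulr_suml coef_sum; apply: eq_bigr => j _.
rewrite mulrC coefMXn coef_comp_Xn //; case: ltnP => //= _; case: ifP => // _.
rewrite coef_poly; case: ltnP => // ge.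
by have := leq_ltn_trans (leq_trans (leq_div (k - b * j) t) (leq_subr _ _)) kN; rewrite ltnNge ge.
Qed.

End QuotientSeries.

(** * Cyclotomic polynomials modulo powers of the variable *)

Section CyclotomicShapes.
Local Open Scope ring_scope.

Lemma primes_prod_gt1 l s : prime l -> all prime s -> (1 < primes_prod (l :: s))%N.
Proof.
move=> pl ps; rewrite /primes_prod big_cons; apply: leq_trans (prime_gt1 pl) _.
by rewrite leq_pmulr // primes_prod_gt0.
Qed.

Lemma sorted_ltn_uniq (s : seq nat) : sorted ltn s -> uniq s.
Proof. by move=> ss; apply: sorted_uniq ss => //; [apply: ltn_trans|apply: ltnn]. Qed.

(** Repeated primes are split off one at a time by [phi_comp_Xn]; [t] is the quotient of [n] by its
    radical. *)
Lemma phi_radical n : (1 < n)%N -> exists t l s,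
  [/\ (0 < t)%N, sorted ltn (l :: s), all prime (l :: s),
      n = (t * primes_prod (l :: s))%N &
      phi n = phi (primes_prod (l :: s)) \Po 'X^t].
Proof.
elim/ltn_ind: n => n IH n1; have n0 := ltnW n1.
have [/hasP[a an /dvdnP[k ek]]|/hasPn sqf] :=
  boolP (has (fun a => a ^ 2 %| n)%N (primes n)).
  have pa : prime a by move: an; rewrite mem_primes => /andP[].
  have a1 := prime_gt1 pa.
  have k0 : (0 < k)%N by case: k ek n0 => // ->.
  have en : n = (k * a * a)%N by rewrite ek mulnA.
  have [||t [l [s [t0 ss ps ekk ephi]]]] := IH (k * a)%N.
  - by rewrite en ltn_Pmulr // muln_gt0 k0 ltnW.
  - by apply: leq_trans a1 _; rewrite leq_pmull.
  exists (t * a)%N, l, s; split=> //.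
  - by rewrite muln_gt0 t0 ltnW.
  - by rewrite en ekk mulnAC.
  have ka0 : (0 < k * a)%N by rewrite muln_gt0 k0 ltnW.
  have := phi_comp_Xn pa ka0; rewrite /phi_cofactor dvdn_mull // -en => <-.
  by rewrite ephi -comp_polyA comp_Xn_poly -exprM mulnC.
have eN : n = primes_prod (primes n).
  rewrite {1}(prod_prime_decomp n0) prime_decompE big_map /primes_prod /=.
  rewrite big_seq [RHS]big_seq; apply: eq_bigr => a an.
  have := sqf a an; rewrite pfactor_dvdn ?n0 //.
    have := an; rewrite -logn_gt0; case: (logn a n) => [|[|//]] // _ _.
  by move: an; rewrite mem_primes => /andP[].
have pp : all prime (primes n).
  by apply/allP => a; rewrite mem_primes => /andP[].
have := sorted_primes n; move: eN pp; case: (primes n) => [|l s] eN pp ss.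
  by move: n1; rewrite eN /primes_prod big_nil.
by exists 1%N, l, s; split; rewrite ?mul1n ?expr1 ?comp_polyXr -?eN.
Qed.

(** The coefficient is minus the Moebius function. The cases are an odd number of distinct primes,
    an even number (so at least two), and a repeated prime. *)
Lemma phi_coef1_cases n : (1 < n)%N ->
  [\/ (phi n)`_1 = 1,
      (phi n)`_1 = -1 /\ (exists p q s, [/\ sorted ltn [:: p, q & s],
         all prime [:: p, q & s], ~~ odd (size s) & n = primes_prod [:: p, q & s]]) |
      (phi n)`_1 = 0 /\ (exists t r, [/\ (1 < t)%N, (1 < r)%N,
         phi n = phi r \Po 'X^t & (phi r)`_1 = 1 \/ (phi r)`_1 = -1])].
Proof.
move=> n1; have [t [l [s [t0 ss ps en ephi]]]] := phi_radical n1.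
have /andP[pl ps'] : prime l && all prime s by [].
have c1 := phi_coef1_primes pl ps' (sorted_ltn_uniq ss).
have [t1|t1] := leqP t 1.
  have et : t = 1%N by apply/eqP; rewrite eqn_leq t1.
  move: en ephi; rewrite et mul1n expr1 comp_polyXr => en ephi.
  rewrite ephi c1 -signr_odd.
  have [os|os] := boolP (odd (size s)); last by apply: Or31.
  case: s os ss ps en {ps' c1 ephi} => // q s os ss ps en.
  by apply: Or32; split=> //; exists l, q, s.
apply: Or33; split.
  by rewrite ephi coef_comp_Xn // dvdn1 gtn_eqF.
exists t, (primes_prod (l :: s)); split=> //; first exact: primes_prod_gt1.
by rewrite c1 -signr_odd; case: (odd _); [right|left].
Qed.

Section TwoSmallestPrimes.
Variables (p q : nat) (s : seq nat).
Hypotheses (ss : sorted ltn [:: p, q & s]) (ps : all prime [:: p, q & s]).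
Hypothesis es : ~~ odd (size s).
Let n := primes_prod [:: p, q & s].

Lemma smallest_primes : [/\ prime p, prime q & (p < q)%N].
Proof. by move: ss ps => /= /andP[-> _] /and3P[-> ->]. Qed.

Lemma large_primes l : l \in s -> prime l /\ (q < l)%N.
Proof.
move=> ls; move: ss ps => /= /andP[_ sq] /and3P[_ _ /allP/(_ l ls) ->].
by have /allP/(_ l ls) := order_path_min ltn_trans sq.
Qed.

Lemma primes_prod_split : n = (p * q * primes_prod s)%N.
Proof. by rewrite /n /primes_prod !big_cons mulnA. Qed.

(** Each remaining prime exceeds [q] and inverts the polynomial modulo [X^(q+1)]; their number is
    even. *)
Lemma large_primes_modX : eq_modX q.+1 (phi n) (phi (p * q)).
Proof.
have [pp pq pltq] := smallest_primes.
have us : uniq s by have := sorted_ltn_uniq ss; rewrite /= => /and3P[_ _ ->].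
have pss : all prime s by move: ps => /= /and3P[].
have := @phi_primes_modX q.+1 (p * q) s; rewrite (negPf es) -primes_prod_split.
apply=> // [|l /large_primes[pl ql]].
  by apply: leq_trans (prime_gt1 pp) _; rewrite leq_pmulr ?prime_gt0.
split=> //; rewrite Euclid_dvdM // !dvdn_prime2 // negb_or !gtn_eqF //.
exact: ltn_trans ql.
Qed.

Lemma smallest_primes_modX :
  eq_modX q.+1 (phi n * ((1 - 'X^p) * (1 - 'X^q))) (1 - 'X).
Proof.
have [pp pq pltq] := smallest_primes.
apply: eq_modX_trans (eq_modXM large_primes_modX (@eq_modX_refl _ _)) _.
rewrite mulrA phi_pq //; last by rewrite neq_ltn pltq.
(* The factor [1 - X^(p q)] is invisible up to degree [q]. *)
move=> k kq; rewrite coefM1BXn; case: ltnP => [_|le]; first by rewrite subr0.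
have := leq_ltn_trans le kq; rewrite ltnS.
have p1 := prime_gt1 pp; have q0 := prime_gt0 pq; nia.
Qed.

Lemma smallest_primes_totient :
  totient n = (p.-1 * q.-1 * totient (primes_prod s))%N.
Proof.
have [pp pq pltq] := smallest_primes.
have pss : all prime s by move: ps => /= /and3P[].
have cpq : coprime p q by rewrite prime_coprime // dvdn_prime2 // neq_ltn pltq.
have cN : coprime (p * q) (primes_prod s).
  rewrite coprimeMl !prime_coprime // !prime_dvd_primes_prod //.
  by apply/andP; split; apply/negP => /large_primes[_]; rewrite ?ltnn // ltnNge ltnW.
by rewrite primes_prod_split totient_coprime // totient_coprime // (totient_prime pp) (totient_prime pq).
Qed.

End TwoSmallestPrimes.

(** Modulo [X^(l+1)], the odd number of primes after [l] makes the full polynomial inverse to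
    [phi (p * q * l)], whose product with [phi (p * q)] is [phi (p * q)] at [X^l], that is
    [1 - X^l]. *)
Lemma third_prime_modX p q l s : sorted ltn [:: p, q, l & s] ->
    all prime [:: p, q, l & s] -> odd (size s) ->
  eq_modX l.+1 (phi (primes_prod [:: p, q, l & s]) * (1 - 'X^l)) (phi (p * q)).
Proof.
move=> ss ps os; have [pp pq pltq] := smallest_primes ss ps.
have /andP[pl pss] : prime l && all prime s by move: ps => /= /and4P[_ _ -> ->].
have [_ ql] := large_primes ss ps (mem_head l s).
have pl' : (p < l)%N by apply: ltn_trans ql.
have pq1 : (1 < p * q)%N.
  by apply: leq_trans (prime_gt1 pp) _; rewrite leq_pmulr ?prime_gt0.
have lpq : ~~ (l %| p * q)%N.
  by rewrite Euclid_dvdM // !dvdn_prime2 // negb_or !gtn_eqF.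
have us : uniq s by have := sorted_ltn_uniq ss; rewrite /= => /and4P[_ _ _ ->].
have := @phi_primes_modX l.+1 (p * q * l) s; rewrite os.
have -> : (p * q * l * primes_prod s = primes_prod [:: p, q, l & s])%N.
  by rewrite /primes_prod !big_cons !mulnA.
set n := primes_prod _ => h.
have {h} : eq_modX l.+1 (phi n * phi (p * q * l)) 1.
  apply: h => // [|a als].
    by apply: leq_trans pq1 _; rewrite leq_pmulr ?prime_gt0.
  have [pa qa] : prime a /\ (q < a)%N by apply: (large_primes ss ps); rewrite in_cons als orbT.
  have la : (l < a)%N.
    have : path ltn l s by move: ss => /= /and3P[].
    by move/(order_path_min ltn_trans)/allP/(_ a als).
  split=> //; rewrite !Euclid_dvdM // !dvdn_prime2 // !negb_or !gtn_eqF //.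
  exact: ltn_trans qa.
move=> inv; have e : eq_modX l.+1 (phi (p * q * l) * phi (p * q)) (1 - 'X^l).
  have := phi_comp_Xn pl (ltnW pq1); rewrite /phi_cofactor (negPf lpq) => <-.
  move=> k; rewrite ltnS coef_comp_Xn ?prime_gt0 // coef1BXn ?prime_gt0 // => kl.
  have [->|k0] := posnP k.
    by rewrite dvdn0 div0n phi_coef0 // (ltn_eqF (prime_gt0 pl)) subr0.
  have [->|nkl] := eqVneq k l.
    rewrite dvdnn divnn (prime_gt0 pl) sub0r.
    rewrite mulnC phi_coef1M ?prime_gt1 ?phi_coef1_prime //.
    by rewrite dvdn_prime2 // ltn_eqF.
  by rewrite gtnNdvd // ?ltn_neqAle ?nkl // subrr.
apply: eq_modX_trans (eq_modXM (@eq_modX_refl _ _) (eq_modX_sym e)) _.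
rewrite mulrA -[X in eq_modX _ _ X]mul1r.
exact: eq_modXM inv (@eq_modX_refl _ _).
Qed.

End CyclotomicShapes.

(** * Semigroup polynomials with at most two cyclotomic factors *)

Section CyclotomicSemigroups.
Local Open Scope ring_scope.

Lemma cofinite_finite (A : set nat) N : (forall k, (N <= k)%N -> A k) ->
  finite_set (~` A)%classic.
Proof.
move=> h; apply: sub_finite_set (finite_II N) => k /= nA; rewrite ltnNge.
by apply/negP => /h.
Qed.

Variable S : set nat.
Hypothesis hS : numerical_semigroup S.

(** * Semigroup polynomials of the form phi (t b) Psi(X^t) *)

Section TwoPrimes.
Variables (t b : nat) (Psi : {poly rat}).
Hypotheses (pt : prime t) (pb : prime b) (tb : t != b).

Let t_gt0 := prime_gt0 pt.
Let b_gt0 := prime_gt0 pb.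

Lemma coprime_tb : coprime t b.
Proof. by rewrite prime_coprime // dvdn_prime2. Qed.

Lemma phi_gluing :
  phi (t * b) * ((1 - 'X^b) * (1 - 'X^t)) = (1 - 'X) * (1 - 'X^(t * b)).
Proof. by rewrite -phi_pq //; ring. Qed.

Lemma dvdn_mul_small i j : (j < t)%N -> (b * j <= t * i)%N ->
  (t %| t * i - b * j)%N = (j == 0%N).
Proof.
move=> jt le; rewrite (dvdn_subr le (dvdn_mulr i (dvdnn t))) Gauss_dvdr ?coprime_tb //.
by case: j jt {le} => [|j] jt; rewrite ?dvdn0 // gtnNdvd.
Qed.

(** The quotient of [S] by [t]; its semigroup polynomial turns out to be [Psi]. *)
Definition quotient_set : set nat := fun i => S (t * i)%N.

Lemma quotient_semigroup : numerical_semigroup quotient_set.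
Proof.
split; first split.
- by rewrite /quotient_set muln0; apply: semigroup0.
- by move=> x y; rewrite /quotient_set mulnDr; apply: semigroupD.
have [N hN] := semigroup_cofinite hS; apply: (@cofinite_finite _ N) => k Nk.
by apply: hN; apply: leq_trans Nk _; rewrite leq_pmull.
Qed.

Hypothesis ePS : semigroup_poly S = phi (t * b) * (Psi \Po 'X^t).

Lemma indic_gluing k : indic S k = \sum_(j < t)
    if (b * j <= k)%N && (t %| k - b * j)%N
    then \sum_(i < ((k - b * j) %/ t).+1) Psi`_i else 0.
Proof.
have h : eq_modX k.+1 (phi (t * b) * ((1 - 'X^b) * (1 - 'X^t)))
                      ((1 - 'X) * (1 - 'X^(t * b))) by rewrite phi_gluing.
have := hseries_factor hS ePS h; rewrite [_ * (1 - 'X^(t * b))]mulrC.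
move=> /(coef_gluing_series t_gt0) /(_ b_gt0 k (ltnSn k)).
by rewrite coef_hseries.
Qed.

(** Only [j = 0] contributes in [indic_gluing], by [dvdn_mul_small]. *)
Lemma indic_quotient i : indic quotient_set i = \sum_(j < i.+1) Psi`_j.
Proof.
have -> : indic quotient_set i = indic S (t * i) by [].
rewrite indic_gluing (bigD1 (Ordinal t_gt0)) //= muln0 subn0 dvdn_mulr // mulKn //.
rewrite [X in _ + X]big1 ?addr0 // => j j0; case: ifP => // /andP[le].
by rewrite dvdn_mul_small // => /eqP ej; case/eqP: j0; apply: val_inj.
Qed.

Lemma quotient_semigroup_poly : semigroup_poly quotient_set = Psi.
Proof.
apply/polyP => k; rewrite (coef_semigroup_poly quotient_semigroup).
case: k => [|k]; rewrite ?indic_quotient; first by rewrite big_ord1 subr0.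
by rewrite big_ord_recr /= addrAC subrr add0r.
Qed.

(** By [indic_quotient] all summands of [indic_gluing] are indicators of the quotient, so nothing
    cancels: [b] lies in [S], and every element of [S] is seen by some summand. *)
Lemma gluing_of_phi k :
  S k <-> exists i j, quotient_set i /\ k = (t * i + b * j)%N.
Proof.
have Sb : S b.
  apply: indic_gt0; rewrite indic_gluing.
  have t1 := prime_gt1 pt; rewrite (bigD1 (Ordinal t1)) //= muln1 leqnn subnn.
  rewrite dvdn0 div0n /= -indic_quotient indicT; last first.
    by rewrite /quotient_set muln0; apply: semigroup0.
  apply: ltr_wpDr => //; apply: sumr_ge0 => j _; case: ifP => // _.
  by rewrite -indic_quotient indic_ge0.
split=> [Sk|[i [j [Si ->]]]]; last first.
  by apply: semigroupD => //; rewrite mulnC; apply: semigroupM.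
have : 0 < indic S k by rewrite indicT.
rewrite indic_gluing; apply: contraPP => nk; apply/negP.
rewrite -leNgt big1 // => j _; case: ifP => // /andP[le dv].
rewrite -indic_quotient indicF // => Sq; apply: nk.
exists ((k - b * j) %/ t)%N, (j : nat); split=> //.
by rewrite mulnC divnK // subnK.
Qed.

End TwoPrimes.

(** Up to degree [l], the Hilbert series times [1 - X^l] looks as if only [p] and [q] were present,
    with summands that are indicators of [S]. In degree [l] that factor subtracts 1, and the result
    is still nonnegative, so [l] is in [S]. *)
Lemma third_prime_elements t b p q l s (Psi : {poly rat}) :
    sorted ltn [:: p, q, l & s] -> all prime [:: p, q, l & s] -> odd (size s) ->
    (t = p /\ b = q) \/ (t = q /\ b = p) -> Psi`_0 = 1 ->
    semigroup_poly S = phi (primes_prod [:: p, q, l & s]) * (Psi \Po 'X^t) ->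
  S b /\ S l.
Proof.
move=> ss ps os etb Psi0 ePS; have := third_prime_modX ss ps os.
set n := primes_prod _ in ePS *; move=> en.
have [pp pq pltq] := smallest_primes ss ps.
have [pl ql] := large_primes ss ps (mem_head l s).
have [pt pb tb] : [/\ prime t, prime b & t != b].
  by case: etb => -[-> ->]; rewrite ?pp ?pq neq_ltn pltq ?orbT.
have [tl bl] : (t < l)%N /\ (b < l)%N.
  by case: etb => -[-> ->]; split=> //; apply: ltn_trans ql.
have etb' : (p * q = t * b)%N by case: etb => -[-> ->] //; rewrite mulnC.
have t0 := prime_gt0 pt; have b0 := prime_gt0 pb; have l0 := prime_gt0 pl.
pose h := hseries S l.+1 * (1 - 'X^l).
have eh : eq_modX l.+1 (h * ((1 - 'X^b) * (1 - 'X^t)))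
                       ((1 - 'X^(t * b)) * (Psi \Po 'X^t)).
  have e : eq_modX l.+1 (phi n * ((1 - 'X^l) * ((1 - 'X^b) * (1 - 'X^t))))
                        ((1 - 'X) * (1 - 'X^(t * b))).
    rewrite -(phi_gluing pt pb tb) -etb' [phi n * _]mulrA.
    exact: eq_modXM en (@eq_modX_refl _ _).
  by have := hseries_factor hS ePS e; rewrite /h -[hseries S l.+1 * _ * _]mulrA [_ * (1 - 'X^(t * b))]mulrC.
have hk k : (k < l)%N -> h`_k = indic S k.
  by move=> kl; rewrite /h coefM1BXn kl subr0 coef_hseries // ltnW.
have hl : h`_l = indic S l - 1.
  rewrite /h coefM1BXn ltnn subnn !coef_hseries // (@indicT S 0%N) //.
  exact: semigroup0.
have series := coef_gluing_series t0 eh b0.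
have g i : (t * i < l)%N -> \sum_(j < i.+1) Psi`_j = indic S (t * i).
  move=> til; rewrite -hk // series; last exact: ltnW.
  rewrite (bigD1 (Ordinal t0)) //= muln0 subn0 dvdn_mulr // mulKn //.
  rewrite [X in _ + X]big1 ?addr0 // => j j0; case: ifP => // /andP[le].
  by rewrite (dvdn_mul_small pt pb) // => /eqP ej; case/eqP: j0; apply: val_inj.
have Sb : S b.
  apply: indic_gt0; rewrite -hk // series; last exact: ltnW.
  have t1 := prime_gt1 pt; rewrite (bigD1 (Ordinal t1)) //= muln1 leqnn subnn.
  rewrite dvdn0 div0n /= big_ord1 Psi0.
  apply: ltr_wpDr => //; apply: sumr_ge0 => j _; case: ifP => // /andP[_ dv].
  have lt : (t * ((b - b * j) %/ t) < l)%N.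
    by rewrite mulnC divnK //; apply: leq_ltn_trans bl; apply: leq_subr.
  by rewrite g ?indic_ge0.
split=> //; apply: indic_gt0; have -> : indic S l = h`_l + 1 by rewrite hl subrK.
apply: ltr_wpDl => //; rewrite series //; apply: sumr_ge0 => j _.
case: ifP => // /andP[le dv].
(* Here [j] is positive because [t] does not divide [l], so the indicator concerns an element below
   [l]. *)
have lt : (t * ((l - b * j) %/ t) < l)%N.
  rewrite mulnC divnK // ltn_subrL l0 muln_gt0 b0 lt0n andbT.
  apply: contraL dv => /eqP ->; rewrite muln0 subn0 dvdn_prime2 //.
  by rewrite ltn_eqF.
by rewrite g ?indic_ge0.
Qed.

(** * Which cyclotomic factors can occur *)

Section Shape.
Variables (p q : nat) (s : seq nat).
Hypotheses (ss : sorted ltn [:: p, q & s]) (ps : all prime [:: p, q & s]).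
Hypothesis es : ~~ odd (size s).
Let n := primes_prod [:: p, q & s].

Lemma totient_primes_gt0 : (0 < totient (primes_prod s))%N.
Proof. by rewrite totient_gt0 primes_prod_gt0 //; move: ps => /= /and3P[]. Qed.

(** The coefficients up to degree [q] put [p] and [q] in [S]. The degree bound
    [totient n <= (p - 1)(q - 1)] then leaves no further prime, and [gluing_of_phi] applies with
    [Psi = 1]. *)
Lemma cyclotomic_length1 : semigroup_poly S = phi n ->
  forall k, S k <-> exists i j, k = (p * i + q * j)%N.
Proof.
move=> ePS; have [pp pq pltq] := smallest_primes ss ps.
have ePS1 : semigroup_poly S = phi n * 1 by rewrite mulr1.
have ind := indic_below_pq hS (prime_gt0 pp) pltq ePS1 (smallest_primes_modX ss ps es).
have Sp : S p.
  apply: indic_gt0; rewrite (ind p (ltnW pltq)) ltnn subnn coef1.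
  rewrite indicT; last exact: semigroup0.
  by rewrite (ltn_eqF pltq) (gtn_eqF (prime_gt0 pp)) !addr0.
have Sq : S q.
  apply: indic_gt0; rewrite (ind q (leqnn q)) eqxx coef1 (gtn_eqF (prime_gt0 pq)) addr0.
  by rewrite ltnNge ltnW //= ltr_wpDl // indic_ge0.
have cpq : coprime p q by rewrite prime_coprime // dvdn_prime2 // neq_ltn pltq.
have := size_semigroup_poly hS (prime_gt0 pp) (prime_gt0 pq) cpq Sp Sq.
rewrite ePS size_phi ltnS smallest_primes_totient //.
have p1 := prime_gt1 pp; have q1 := prime_gt1 pq => le.
have {le} tot1 : (totient (primes_prod s) <= 1)%N.
  rewrite leqNgt; apply/negP => tot; move: le; rewrite leqNgt => /negP; apply.
  by rewrite -[X in (X < _)%N]muln1 ltn_pmul2l // muln_gt0; apply/andP; lia.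
have s0 : s = [::].
  move: tot1; have := large_primes ss ps; have : all prime s by move: ps => /= /and3P[].
  case: (s) => // l s' ps' /(_ l (mem_head _ _))[pl ql].
  rewrite leqNgt totient_gt1 -ltnNge; move: ps' => /= /andP[_ ps'].
  rewrite /primes_prod big_cons ltnS => /(leq_trans (leq_pmulr l (primes_prod_gt0 ps'))).
  by lia.
move=> k; have ePS' : semigroup_poly S = phi (p * q) * (1 \Po 'X^p).
  rewrite ePS /n s0 /primes_prod !big_cons big_nil muln1.
  by rewrite -polyC1 comp_polyC mulr1.
have npq : p != q by rewrite neq_ltn pltq.
have S1 i : quotient_set p i.
  apply: (semigroup_poly1 (quotient_semigroup pp)).
  exact: quotient_semigroup_poly ePS'.
rewrite (gluing_of_phi pp pq npq ePS'); split=> [[i [j [_ ->]]]|[i [j ->]]].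
  by exists i, j.
by exists i, j.
Qed.

Section Length2.
Variables (t : nat) (Psi : {poly rat}).
Hypotheses (t_gt1 : (1 < t)%N) (Psi0 : Psi`_0 = 1).
Hypothesis sizePsi : (1 < size (Psi \Po 'X^t))%N.
Hypothesis ePS : semigroup_poly S = phi n * (Psi \Po 'X^t).

(** The second factor is nonconstant, so the degree of the semigroup polynomial exceeds
    [totient n]. *)
Lemma too_small_elements a b : (0 < a)%N -> (0 < b)%N -> coprime a b -> S a -> S b ->
  (totient n < a.-1 * b.-1)%N.
Proof.
move=> a0 b0 cab Sa Sb; have := size_semigroup_poly hS a0 b0 cab Sa Sb.
have R0 : Psi \Po 'X^t != 0 by rewrite -size_poly_gt0 ltnW.
rewrite ePS size_mul ?phi_neq0 // size_phi addSn /=.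
by move: (size _) sizePsi (totient n) (a.-1 * b.-1)%N; clear => x h y z; lia.
Qed.

Lemma indic_length2 k : (0 < k)%N -> (k <= q)%N -> indic S k =
  (if (k < p)%N then 0 else indic S (k - p)) + (k == q)%:R +
  (if (t %| k)%N then Psi`_(k %/ t) else 0).
Proof.
move=> k0 kq; have [pp pq pltq] := smallest_primes ss ps.
have := indic_below_pq hS (prime_gt0 pp) pltq ePS (smallest_primes_modX ss ps es) kq.
by rewrite coef_comp_Xn // ltnW.
Qed.

(** Otherwise [S] would contain coprime elements bounded by [p] and [q], against
    [too_small_elements]. *)
Lemma cyclotomic_length2_t : Psi`_1 = 1 \/ Psi`_1 = -1 -> t = p \/ t = q.
Proof.
move=> hPsi1; have [pp pq pltq] := smallest_primes ss ps.
have t0 : (0 < t)%N by apply: ltnW.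
have p0 := prime_gt0 pp; have q0 := prime_gt0 pq.
have S0 : indic S 0 = 1 by rewrite indicT //; apply: semigroup0.
have small a b : (0 < a <= p)%N -> (0 < b <= q)%N -> coprime a b ->
    S a -> S b -> False.
  move=> /andP[a0 ap] /andP[b0 bq] cab Sa Sb.
  have := too_small_elements a0 b0 cab Sa Sb.
  rewrite smallest_primes_totient // ltnNge => /negP; apply.
  apply: leq_trans (_ : p.-1 * q.-1 <= _)%N.
    by apply: leq_mul; rewrite -ltnS !prednK.
  by rewrite leq_pmulr // totient_primes_gt0.
have cpq : coprime p q by rewrite prime_coprime // dvdn_prime2 // neq_ltn pltq.
have indt : (t <= q)%N -> indic S t =
    (if (t < p)%N then 0 else indic S (t - p)) + (t == q)%:R + Psi`_1.
  by move=> tq; rewrite indic_length2 // dvdnn divnn t0.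
have Sp : ~~ (t %| p)%N -> S p.
  move=> /negPf tp; apply: indic_gt0; rewrite indic_length2 ?(ltnW pltq) //.
  by rewrite ltnn subnn S0 (ltn_eqF pltq) tp !addr0.
have tnp : t <> p -> ~~ (t %| p)%N.
  move=> tp; apply/negP; case/primeP: pp => _ /[apply]; rewrite (gtn_eqF t_gt1).
  by move/eqP.
have [tp|pt|] := ltngtP t p; last by left.
  (* For [t < p] the indicator of [t] is [Psi_1], which must be 1; then [t] and [p] are coprime
     elements of [S]. *)
  have {indt} := indt (ltnW (ltn_trans tp pltq)).
  rewrite tp (ltn_eqF (ltn_trans tp pltq)) !add0r => indt.
  case: hPsi1 => ePsi1; last by have := indic_ge0 S t; rewrite indt ePsi1 oppr_ge0 ler10.
  have St : S t by apply: indic_gt0; rewrite indt ePsi1.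
  have ntp : ~~ (t %| p)%N by apply: tnp => e; rewrite e ltnn in tp.
  exfalso; apply: (small p t) => //; rewrite ?p0 ?t0 ?leqnn //.
  - by rewrite ltnW // (ltn_trans tp).
  - by rewrite prime_coprime // gtnNdvd.
  exact: Sp.
have {}Sp : S p by apply/Sp/tnp => e; rewrite e ltnn in pt.
have [tq|qt|] := ltngtP t q; last by right.
  (* For [p < t < q] the indicators of [t] and [t - p] differ by [Psi_1], which is not 0. So [t] is
     in [S], and [p] does not divide it, as both indicators would be 1. *)
  have {indt} := indt (ltnW tq); rewrite ltnNge (ltnW pt) /= (ltn_eqF tq) addr0 => indt.
  have [St|nSt] := pselect (S t); last first.
    exfalso; move: indt; rewrite (indicF nSt) => indt.
    have Stp : S (t - p)%N.
      apply: indic_gt0; have := indic_ge0 S (t - p).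
      by case: hPsi1 => ePsi1; move: indt; rewrite ePsi1; lra.
    by apply: nSt; rewrite -(subnK (ltnW pt)); apply: semigroupD.
  have [pdt|npt] := boolP (p %| t)%N.
    exfalso; have Stp : S (t - p)%N.
      have /dvdnP[c ec] : (p %| t - p)%N by rewrite dvdn_subr // ltnW.
      by rewrite ec; apply: semigroupM.
    move: indt; rewrite (indicT St) (indicT Stp).
    by case: hPsi1 => ->; lra.
  by exfalso; apply: (small p t) => //; rewrite ?p0 ?t0 ?leqnn ?(ltnW tq) // prime_coprime.
(* For [t > q] the second factor has no term in degrees 1 to [q], so [p] and [q] both lie in [S]. *)
have Sq : S q.
  apply: indic_gt0; rewrite indic_length2 // eqxx gtnNdvd // addr0.
  by rewrite ltnNge (ltnW pltq) /= ltr_wpDl // indic_ge0.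
by exfalso; apply: (small p q) => //; rewrite ?p0 ?q0 ?leqnn.
Qed.

(** A third prime [l] would put [b] and [l] in [S], although [totient n] is at least
    [(b - 1)(l - 1)]. *)
Lemma cyclotomic_length2_s : t = p \/ t = q -> s = [::].
Proof.
move=> etpq; have [pp pq pltq] := smallest_primes ss ps.
pose b := if t == p then q else p.
have etb : (t = p /\ b = q) \/ (t = q /\ b = p).
  by rewrite /b; case: etpq => ->; rewrite ?eqxx ?(gtn_eqF pltq); auto.
have tot := smallest_primes_totient ss ps.
move: ss ps es (large_primes ss ps) ePS tot too_small_elements; rewrite /n.
case: (s) => // l s' ss' ps' /= /negPn os lp ePS' tot small.
have [pl ql] := lp l (mem_head _ _).
have [Sb Sl] := third_prime_elements ss' ps' os etb Psi0 ePS'.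
have [pb bq] : prime b /\ (b <= q)%N by case: etb => -[_ ->]; rewrite // ltnW.
have bl : (b < l)%N by apply: leq_ltn_trans ql.
have cbl : coprime b l by rewrite prime_coprime // dvdn_prime2 // ltn_eqF.
have := small b l (prime_gt0 pb) (prime_gt0 pl) cbl Sb Sl.
have ps'' : all prime s' by move: ps' => /= /and4P[].
have cl : coprime l (primes_prod s').
  rewrite prime_coprime // prime_dvd_primes_prod //.
  by have := sorted_ltn_uniq ss'; rewrite /= => /and4P[_ _ + _].
have el : primes_prod (l :: s') = (l * primes_prod s')%N by rewrite /primes_prod big_cons.
rewrite tot el totient_coprime // (totient_prime pl).
have tot0 : (0 < totient (primes_prod s'))%N by rewrite totient_gt0 primes_prod_gt0.
rewrite ltnNge => /negP[]; rewrite mulnA; apply: leq_trans (leq_pmulr _ tot0).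
rewrite leq_mul2r; apply/orP; right.
by case: etb => -[_ ->]; [apply: leq_pmull|apply: leq_pmulr];
  rewrite ltn_predRL prime_gt1.
Qed.

End Length2.

End Shape.

End CyclotomicSemigroups.

(** * Explicit minimal presentations *)

Section Presentations.
Local Open Scope nat_scope.

(** Minimality is certified one element at a time: a generator occurs in each of its expressions,
    and a relation is separated from the others by a congruence. *)
Lemma complete_intersection_intro (S : set nat) (e : nat) (n : 'I_e -> nat)
    (f : 'I_e.-1 -> {ffun 'I_e -> nat} * {ffun 'I_e -> nat}) :
    S = span n [set: 'I_e]%SET ->
    (forall i (c : 'I_e -> nat), n i = \sum_j c j * n j -> 0 < c i) ->
    (forall k, weight n (f k).1 = weight n (f k).2) ->
    (forall R, @congruence {ffun 'I_e -> nat} R -> (forall k, R (f k)) ->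
       forall a b, weight n a = weight n b -> R (a, b)) ->
    (forall k, exists R, [/\ @congruence {ffun 'I_e -> nat} R,
       forall l, l != k -> R (f l) & ~ R (f k)]) ->
  complete_intersection S.
Proof.
move=> eS gen fK fgen fmin.
have finj : injective f.
  move=> k l kl; apply/eqP/negPn/negP => nkl; have [R [_ Rl nR]] := fmin k.
  by apply: nR; rewrite kl; apply: Rl; rewrite eq_sym.
have delta j : n j = \sum_i (i == j : nat) * n i.
  rewrite (bigD1 j) //= eqxx mul1n big1 ?addn0 // => i /negPf->.
  by rewrite mul0n.
exists e, n, (range f); split.
- move=> i j nij; apply/eqP; apply: contraT => ij.
  by have := gen i _ (etrans nij (delta j)); rewrite (negPf ij).
- split=> [|H Hn HS]; first by rewrite smallest_submonoid_span.
  apply/seteqP; split=> // _ [i _ <-]; apply: contrapT => nH.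
  (* The sums avoiding generator [i] form a submonoid that contains [H] but not [n i]. *)
  pose T : set nat := fun x => exists2 c : 'I_e -> nat, x = \sum_j c j * n j & c i = 0.
  have sT : submonoid T.
    split; first by exists (fun=> 0) => //; rewrite big1.
    move=> _ _ [c -> c0] [c' -> c0']; exists (fun j => c j + c' j).
      by rewrite -big_split; apply: eq_bigr => j _; rewrite mulnDl.
    by rewrite c0 c0'.
  have HT : (H `<=` T)%classic.
    move=> x Hx; have [j _ nj] := Hn x Hx; exists (fun k => (k == j : nat)).
      by rewrite -nj -delta.
    by case: eqP => // ij; case: nH; rewrite ij nj.
  have : S (n i).
    rewrite eS; exists (fun j => (j == i : nat)).
    by rewrite {1}delta; apply: eq_bigl => j; rewrite inE.
  rewrite -HS => /(smallest_sub sT HT)[c ec c0].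
  by have := gen i c ec; rewrite c0.
- split=> [|H Hf HK].
    apply/seteqP; split=> [|[a b] wab].
      apply: smallest_sub => [|_ [k _ <-]]; last exact: fK.
      split=> // [a b c|a b c]; rewrite /kernel_congruence /=; first by move=> -> ->.
      move=> h; under eq_bigr do rewrite ffunE mulnDl.
      by under [RHS]eq_bigr do rewrite ffunE mulnDl; rewrite !big_split /= h.
    move=> R [cR Rf]; apply: (fgen R cR) wab => k; apply: Rf.
    by exists k.
  apply/seteqP; split=> // _ [k _ <-]; apply: contrapT => nH.
  have [R [cR Rl nR]] := fmin k; apply: nR.
  have : kernel_congruence n (f k) by apply: fK.
  rewrite -HK; apply: smallest_sub => // x Hx.
  have [l _ fl] := Hf x Hx; rewrite -fl; apply: Rl.
  by apply: contraPneq Hx => lk; rewrite -fl lk.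
by apply: card_eq_trans (inj_card_eq _) (card_esym card_II) => k l _ _; apply: finj.
Qed.

Definition vec e (s : seq nat) : {ffun 'I_e -> nat} := [ffun i => nth 0 s (val i)].

Lemma vec3E (a : {ffun 'I_3 -> nat}) : exists x y z, a = vec 3 [:: x; y; z].
Proof.
exists (a (inord 0)), (a (inord 1)), (a (inord 2)).
by apply/ffunP => -[[|[|[|//]]] h]; rewrite ffunE /=; congr (a _); apply: val_inj; rewrite /= inordK.
Qed.

Lemma vec2E (a : {ffun 'I_2 -> nat}) : exists x y, a = vec 2 [:: x; y].
Proof.
exists (a (inord 0)), (a (inord 1)).
by apply/ffunP => -[[|[|//]] h]; rewrite ffunE /=; congr (a _); apply: val_inj; rewrite /= inordK.
Qed.

Lemma vec3D x y z x' y' z' : (vec 3 [:: x; y; z] + vec 3 [:: x'; y'; z'])%R =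
  vec 3 [:: x + x'; y + y'; z + z'].
Proof. by apply/ffunP => -[[|[|[|//]]] h]; rewrite !ffunE. Qed.

Lemma vec2D x y x' y' : (vec 2 [:: x; y] + vec 2 [:: x'; y'])%R =
  vec 2 [:: x + x'; y + y'].
Proof. by apply/ffunP => -[[|[|//]] h]; rewrite !ffunE. Qed.

Lemma weight3 n x y z :
  weight n (vec 3 [:: x; y; z]) = x * n ord0 + y * n (lift ord0 ord0) + z * n ord_max.
Proof.
rewrite /weight !big_ord_recl big_ord0 !ffunE /= addn0 addnA.
by congr (_ + _ * n _); apply: val_inj.
Qed.

Lemma weight2 n x y : weight n (vec 2 [:: x; y]) = x * n ord0 + y * n ord_max.
Proof.
rewrite /weight !big_ord_recl big_ord0 !ffunE /= addn0.
by congr (_ + _ * n _); apply: val_inj.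
Qed.

Lemma complete_intersection_setT (S : set nat) :
  (forall k, S k) -> complete_intersection S.
Proof.
move=> ST; apply: (@complete_intersection_intro S 1 (fun=> 1) (fun=> (0%R, 0%R))).
- apply/seteqP; split=> k // _; exists (fun=> k).
  by rewrite (eq_bigl xpredT) ?big_ord1 ?muln1 // => i; rewrite inE.
- by move=> i c; rewrite big_ord1 muln1 (_ : i = ord0) ?[i]ord1 // => <-.
- by case.
- move=> R [Rxx _ _ _] _ a b; rewrite /weight !big_ord1 !muln1 => ab.
  by have -> : a = b; [apply/ffunP => i; rewrite ord1|apply: Rxx].
- by case.
Qed.

Lemma congruence_iter (M : nmodType) (R : set (M * M)) (x y w : M) m :
  congruence R -> R (x, y) -> R (w + x *+ m, w + y *+ m)%R.
Proof.
move=> [Rxx _ Rtr Radd] Rxy; elim: m => [|m IH]; first by rewrite !mulr0n.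
apply: (Rtr _ (w + x *+ m + y)%R).
  rewrite mulrSr addrA addrC [X in (_, X)]addrC.
  exact: Radd.
by rewrite mulrSr [X in (_, X)]addrA; apply: Radd.
Qed.

Lemma spanT_weight e (n : 'I_e -> nat) k :
  span n [set: 'I_e]%SET k <-> exists a : {ffun 'I_e -> nat}, k = weight n a.
Proof.
split=> [[c ->]|[a ->]].
  exists [ffun i => c i]; rewrite /weight; under [RHS]eq_bigr do rewrite ffunE.
  by apply: eq_bigl => i; rewrite inE.
by exists a; apply: eq_bigl => i; rewrite inE.
Qed.

(** Uniqueness of the normal forms to which the explicit relations below reduce a vector. *)
Lemma eq_mod_coprime a b x y x' y' : coprime a b -> x < b -> x' < b ->
  x * a + y * b = x' * a + y' * b -> x = x' /\ y * b = y' * b.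
Proof.
move=> cab; wlog xx : x y x' y' / x <= x' => [hw xb xb' e|_ xb' e].
  case/orP: (leq_total x x') => xx; first exact: hw xx xb xb' e.
  by have [-> ->] := hw _ _ _ _ xx xb' xb (esym e).
have e' : (x' - x) * a + y' * b = y * b by rewrite mulnBl; have := leq_mul xx (leqnn a); lia.
have : b %| (x' - x) * a by rewrite -(dvdn_addl _ (dvdn_mull y' (dvdnn b))) e' dvdn_mull.
rewrite Gauss_dvdl 1?coprime_sym // => dv.
suff exx : x = x' by split=> //; move: e; rewrite exx; lia.
apply/eqP; rewrite eqn_leq xx /= -subn_eq0; apply: contraTT dv => nz.
by rewrite gtnNdvd ?lt0n //; apply: leq_ltn_trans xb'; apply: leq_subr.
Qed.

(** * Two coprime generators and their single relation *)

Section TwoGenerators.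
Variables (a b : nat).
Hypotheses (a_gt1 : 1 < a) (b_gt1 : 1 < b) (cab : coprime a b).

Definition gens2 (i : 'I_2) : nat := nth 0 [:: a; b] i.

Definition rel2 (_ : 'I_1) : {ffun 'I_2 -> nat} * {ffun 'I_2 -> nat} :=
  (vec 2 [:: b; 0], vec 2 [:: 0; a]).

Lemma complete_intersection2 (S : set nat) :
  (forall k, S k <-> exists x y, k = x * a + y * b) -> complete_intersection S.
Proof.
move=> SE.
have wE x y : weight gens2 (vec 2 [:: x; y]) = x * a + y * b by rewrite weight2.
apply: (@complete_intersection_intro S 2 gens2 rel2).
- apply/seteqP; split=> k.
    by move=> /SE[x [y ->]]; apply/spanT_weight; exists (vec 2 [:: x; y]); rewrite wE.
  by move=> /spanT_weight[c ->]; have [x [y ->]] := vec2E c; apply/SE; exists x, y.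
- move=> i c; rewrite !big_ord_recl big_ord0 addn0 lt0n /gens2 /= => e.
  apply/negP => /eqP ci.
  have nd x y : 1 < y -> coprime x y -> ~~ (y %| x).
    move=> y1 cxy; apply/negP => /gcdn_idPr; rewrite (eqP cxy) => ey.
    by rewrite -ey in y1.
  case: i e ci => -[|[|//]] h /= e ci.
    have := nd a b b_gt1 cab; rewrite e (_ : c ord0 = 0) ?dvdn_mull //.
    by move: ci; congr (c _ = _); apply: val_inj.
  have := nd b a a_gt1; rewrite coprime_sym => /(_ cab).
  rewrite e (_ : c (lift ord0 ord0) = 0) ?addn0 ?dvdn_mull //.
  by move: ci; congr (c _ = _); apply: val_inj.
- by move=> k; rewrite !wE mul0n mul0n addn0 mulnC.
- move=> R cR Rf x y.
  have [x0 [x1 ->]] := vec2E x; have [y0 [y1 ->]] := vec2E y; rewrite !wE.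
  have [_ Rsy Rtr _] := cR.
  (* The relation reduces the first coordinate modulo [b]; reduced vectors of equal weight
     coincide. *)
  have red z0 z1 : R (vec 2 [:: z0; z1], vec 2 [:: z0 %% b; z1 + z0 %/ b * a]).
    have := congruence_iter (vec 2 [:: z0 %% b; z1]) (z0 %/ b) cR (Rf ord0).
    have mul m u v : (vec 2 [:: u; v] *+ m)%R = vec 2 [:: m * u; m * v].
      elim: m => [|m IH]; first by rewrite mulr0n; apply/ffunP => -[[|[|//]] k]; rewrite !ffunE.
      by rewrite mulrS IH vec2D !mulSn.
    rewrite !mul !vec2D !muln0 !addn0 addnC -divn_eq.
    by rewrite mulnC.
  move=> e; apply: (Rtr _ _ _ (red x0 x1)); apply: (Rsy); apply: (Rtr _ _ _ (red y0 y1)).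
  have [|||e0 e1] := @eq_mod_coprime a b (x0 %% b) (x1 + x0 %/ b * a) (y0 %% b) (y1 + y0 %/ b * a) cab.
  - by rewrite ltn_mod ltnW.
  - by rewrite ltn_mod ltnW.
  - move: e; rewrite {1}(divn_eq x0 b) {1}(divn_eq y0 b); nia.
  rewrite e0; move/eqP: e1; rewrite eqn_pmul2r ?(ltnW b_gt1) // => /eqP ->.
  by case: cR.
- move=> k; exists (fun p => p.1 = p.2); split.
  + by split=> //= [x y z -> ->|x y z ->].
  + by move=> l; rewrite !ord1.
  move=> /= /ffunP/(_ ord0); rewrite !ffunE /= => e.
  by move: b_gt1; rewrite e.
Qed.

End TwoGenerators.

(** * The gluing t<u, v> + b N with its two relations *)

Section ThreeGenerators.
Variables (t u v b al be : nat).
Hypotheses (t_gt1 : 1 < t) (u_gt1 : 1 < u) (v_gt1 : 1 < v).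
Hypotheses (al_gt0 : 0 < al) (be_gt0 : 0 < be).
Hypotheses (cuv : coprime u v) (ctb : coprime t b) (eb : b = al * u + be * v).

Definition gens3 (i : 'I_3) : nat := nth 0 [:: t * u; t * v; b] i.

Definition rel3 (k : 'I_2) : {ffun 'I_3 -> nat} * {ffun 'I_3 -> nat} :=
  if k == ord0 then (vec 3 [:: v; 0; 0], vec 3 [:: 0; u; 0])
  else (vec 3 [:: 0; 0; t], vec 3 [:: al; be; 0]).

Lemma weight_gens3 x y z :
  weight gens3 (vec 3 [:: x; y; z]) = x * (t * u) + y * (t * v) + z * b.
Proof. by rewrite weight3. Qed.

Lemma not_dvdn_coprime x y : 1 < y -> coprime x y -> ~~ (y %| x).
Proof.
move=> y1 cxy; apply/negP => /gcdn_idPr; rewrite (eqP cxy) => ey.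
by rewrite -ey in y1.
Qed.

(** In an expression of [t u] or [t v] the coefficient of [b] is a multiple of [t], hence 0 as [u]
    and [v] are below [b]; then coprimality of [u] and [v] decides. For [b] itself, [t] does not
    divide it. *)
Lemma gens3_minimal x y z (k : nat) : k = x * (t * u) + y * (t * v) + z * b ->
  [/\ k = t * u -> 0 < x, k = t * v -> 0 < y & k = b -> 0 < z].
Proof.
move=> ek; have t0 := ltnW t_gt1.
have red x' w w' : 1 < w' -> coprime w w' -> w < b ->
    t * w = x' * (t * w') + z * b -> False.
  move=> w1 cw wb e.
  have dx : t %| x' * (t * w') by rewrite mulnCA dvdn_mulr.
  have : t %| z * b by rewrite -(dvdn_addr _ dx) -e dvdn_mulr.
  rewrite Gauss_dvdl // => /dvdnP[d ed].
  have {}e : w = x' * w' + d * b.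
    by apply/eqP; rewrite -(eqn_pmul2l t0) e ed; apply/eqP; ring.
  case: d e {ed} => [|d] e; last by move: wb; rewrite e mulSn; lia.
  by have := not_dvdn_coprime w1 cw; rewrite e addn0 dvdn_mull.
have ub : u < b.
  by rewrite eb; apply: leq_ltn_trans (leq_pmull u al_gt0) _; rewrite -[X in X < _]addn0 ltn_add2l muln_gt0 be_gt0 ltnW.
have vb : v < b.
  by rewrite eb; apply: leq_ltn_trans (leq_pmull v be_gt0) _; rewrite -[X in X < _]add0n ltn_add2r muln_gt0 al_gt0 ltnW.
split=> kE; rewrite lt0n; apply/negP => /eqP e0; move: ek; rewrite kE e0 ?mul0n ?add0n ?addn0.
- exact: red v_gt1 cuv ub.
- by apply: red u_gt1 _ vb; rewrite coprime_sym.
move=> e; have := not_dvdn_coprime t_gt1 (_ : coprime b t).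
rewrite coprime_sym => /(_ ctb) /negP; apply.
by rewrite e dvdn_add // mulnCA dvdn_mulr.
Qed.

(** The gluing relation brings the last coordinate below [t], the other one then brings the first
    below [v]; two uses of [eq_mod_coprime] identify the normal forms. *)
Lemma rel3_generates (R : set ({ffun 'I_3 -> nat} * {ffun 'I_3 -> nat})) :
    @congruence {ffun 'I_3 -> nat} R -> (forall k, R (rel3 k)) ->
  forall x y, weight gens3 x = weight gens3 y -> R (x, y).
Proof.
move=> cR Rf x y.
have [x0 [x1 [x2 ->]]] := vec3E x; have [y0 [y1 [y2 ->]]] := vec3E y.
rewrite !weight_gens3; have [Rxx Rsy Rtr _] := cR.
have mul m c0 c1 c2 : (vec 3 [:: c0; c1; c2] *+ m)%R = vec 3 [:: m * c0; m * c1; m * c2].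
  elim: m => [|m IH]; first by rewrite mulr0n; apply/ffunP => -[[|[|[|//]]] k]; rewrite !ffunE.
  by rewrite mulrS IH vec3D !mulSn.
have red z0 z1 z2 : R (vec 3 [:: z0; z1; z2],
    vec 3 [:: z0 + z2 %/ t * al; z1 + z2 %/ t * be; z2 %% t]).
  have := congruence_iter (vec 3 [:: z0; z1; z2 %% t]) (z2 %/ t) cR (Rf (lift ord0 ord0)).
  by rewrite /rel3 /= !mul !vec3D !muln0 !addn0 [z2 %% t + _]addnC -divn_eq.
have red' z0 z1 z2 : R (vec 3 [:: z0; z1; z2],
    vec 3 [:: z0 %% v; z1 + z0 %/ v * u; z2]).
  have := congruence_iter (vec 3 [:: z0 %% v; z1; z2]) (z0 %/ v) cR (Rf ord0).
  by rewrite /rel3 /= !mul !vec3D !muln0 !addn0 [z0 %% v + _]addnC -divn_eq.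
have t0 := ltnW t_gt1; have v0 := ltnW v_gt1.
move=> e; apply: (Rtr _ _ _ (Rtr _ _ _ (red x0 x1 x2) (red' _ _ _))); apply: (Rsy).
apply: (Rtr _ _ _ (Rtr _ _ _ (red y0 y1 y2) (red' _ _ _))).
have cbt : coprime b t by rewrite coprime_sym.
pose X z0 z2 := z0 + z2 %/ t * al; pose Y z1 z2 := z1 + z2 %/ t * be.
have wt z0 z1 z2 : z0 * (t * u) + z1 * (t * v) + z2 * b =
    z2 %% t * b + (X z0 z2 * u + Y z1 z2 * v) * t.
  by rewrite {1}(divn_eq z2 t) eb /X /Y; ring.
move: e; rewrite !wt => /(eq_mod_coprime cbt (ltn_pmod _ t0) (ltn_pmod _ t0))[e2].
move=> /eqP; rewrite eqn_pmul2r // => /eqP e01; rewrite e2 -/(X x0 x2) -/(Y x1 x2).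
rewrite -/(X y0 y2) -/(Y y1 y2).
have wt' z0 z1 : z0 * u + z1 * v = z0 %% v * u + (z1 + z0 %/ v * u) * v.
  by rewrite {1}(divn_eq z0 v); ring.
move: e01; rewrite wt' [RHS]wt' => /(eq_mod_coprime cuv (ltn_pmod _ v0) (ltn_pmod _ v0))[e0].
by move=> /eqP; rewrite eqn_pmul2r // => /eqP e1; rewrite e0 e1.
Qed.

(* The two congruences separating one relation from the other: equality of the
   last coordinate, and the Rees congruence of the ideal generated by the two
   sides of the gluing relation. *)
Lemma rel3_minimal k : exists R, [/\ @congruence {ffun 'I_3 -> nat} R,
  forall l, l != k -> R (rel3 l) & ~ R (rel3 k)].
Proof.
case: (eqVneq k ord0) => [->|k0].
  pose U (x : {ffun 'I_3 -> nat}) :=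
    (t <= x ord_max) \/ (al <= x ord0 /\ be <= x (lift ord0 ord0)).
  exists (fun p => p.1 = p.2 \/ (U p.1 /\ U p.2)); split.
  - split=> /=.
    + by left.
    + by move=> x y [->|[? ?]]; [left|right].
    + by move=> x y z [->|[? ?]] [<-|[? ?]]; [left|right|right|right].
    have UD x w : U x -> U (x + w)%R.
      rewrite /U !ffunE => -[h|[h h']]; [left|right; split]; exact: leq_trans (leq_addr _ _).
    by move=> x y w [->|[/UD-/(_ w) ? /UD-/(_ w) ?]]; [left|right].
  - move=> l l0; rewrite /rel3 (negPf l0); right; rewrite /U !ffunE /=.
    by split; [left|right].
  rewrite /rel3 eqxx /= => -[/ffunP/(_ ord0) h|[[h|[_ h]] _]]; move: h; rewrite !ffunE /=.
  - by move=> v0; move: v_gt1; rewrite v0.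
  - by rewrite leqn0 => /eqP t0; move: t_gt1; rewrite t0.
  - by rewrite leqn0 => /eqP b0; move: be_gt0; rewrite b0.
exists (fun p : {ffun 'I_3 -> nat} * {ffun 'I_3 -> nat} => p.1 ord_max = p.2 ord_max); split.
- by split=> [|||x y z] /=; [by []|by move=> x y ->|by move=> x y z -> ->|rewrite !ffunE => ->].
- move=> l lk; rewrite /rel3; have -> : l == ord0.
    by case: l k lk k0 => -[|[|//]] ? [[|[|//]] ?].
  by rewrite /= !ffunE.
by rewrite /rel3 (negPf k0) /= !ffunE /= => t0; move: t_gt1; rewrite t0.
Qed.

Lemma complete_intersection3 (S : set nat) :
    (forall k, S k <-> exists x y z, k = x * (t * u) + y * (t * v) + z * b) ->
  complete_intersection S.
Proof.
move=> SE; apply: (@complete_intersection_intro S 3 gens3 rel3).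
- apply/seteqP; split=> k.
    move=> /SE[x [y [z ->]]]; apply/spanT_weight.
    by exists (vec 3 [:: x; y; z]); rewrite weight_gens3.
  move=> /spanT_weight[c ->]; have [x [y [z ->]]] := vec3E c.
  by apply/SE; exists x, y, z; rewrite weight_gens3.
- move=> i c; rewrite !big_ord_recl big_ord0 addn0 addnA => /gens3_minimal[h0 h1 h2].
  case: i h0 h1 h2 => -[|[|[|//]]] h h0 h1 h2.
  + by rewrite (_ : Ordinal h = ord0) ?h0 //; apply: val_inj.
  + by rewrite (_ : Ordinal h = lift ord0 ord0) ?h1 //; apply: val_inj.
  by rewrite (_ : Ordinal h = lift ord0 (lift ord0 ord0)) ?h2 //; apply: val_inj.
- move=> k; rewrite /rel3; case: ifP => _ /=; rewrite !weight_gens3.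
    by ring.
  by rewrite eb; ring.
- exact: rel3_generates.
- exact: rel3_minimal.
Qed.

End ThreeGenerators.

End Presentations.

(** * At most two cyclotomic factors force a complete intersection *)

Section CyclotomicIsCompleteIntersection.
Local Open Scope ring_scope.

Lemma complete_intersection_gluing (S : set nat) t b u v :
    prime t -> prime b -> t != b -> prime u -> prime v -> u != v ->
    (exists x y, b = u * x + v * y)%N ->
    (forall k, S k <-> exists x y z, k = t * (u * x + v * y) + b * z)%N ->
  complete_intersection S.
Proof.
move=> pt pb tb pu pv uv [x0 [y0 eb]] SE.
have [t1 b1 u1 v1] : [/\ 1 < t, 1 < b, 1 < u & 1 < v]%N by rewrite !prime_gt1.
have ctb : coprime t b by rewrite prime_coprime // dvdn_prime2.
have cuv : coprime u v by rewrite prime_coprime // dvdn_prime2.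
(* If the prime [b] is a multiple of [u] or [v], it equals that prime, and one of the three
   generators is redundant. *)
have two w w' z : prime w -> prime w' -> w != w' -> b = (w' * z)%N ->
    (forall k, S k <-> exists x y z, k = t * (w * x + w' * y) + b * z)%N ->
    complete_intersection S.
  move=> pw pw' ww' ebw SE'.
  have ew' : w' = b.
    by apply/eqP; rewrite -dvdn_prime2 // ebw dvdn_mulr.
  apply: (@complete_intersection2 (t * w) b) => // [||k].
  - by apply: leq_trans t1 _; rewrite leq_pmulr ?prime_gt0.
  - by rewrite coprimeMl ctb prime_coprime // dvdn_prime2 // -ew'.
  split=> [/SE'[x [y [c ->]]]|[x [y ->]]].
    by exists x, (t * y + c)%N; rewrite ew'; ring.
  by apply/SE'; exists x, 0%N, y; ring.
case: (posnP x0) => [x00|x0gt].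
  by apply: (two u v y0) => //; rewrite eb x00 muln0.
case: (posnP y0) => [y00|y0gt].
  apply: (two v u x0) => //; [by rewrite eq_sym|by rewrite eb y00 muln0 addn0|].
  by move=> k; split=> [/SE|] [x [y [z ->]]]; [|apply/SE]; exists y, x, z; ring.
apply: (@complete_intersection3 t u v b x0 y0) => //.
  by rewrite eb; ring.
by move=> k; split=> [/SE|] [x [y [z ->]]]; [|apply/SE]; exists x, y, z; ring.
Qed.

Lemma complete_intersection_length2 (S : set nat) (n m : nat) :
    numerical_semigroup S -> (1 < m)%N ->
    semigroup_poly S = phi n * phi m ->
    (exists p q s, [/\ sorted ltn [:: p, q & s], all prime [:: p, q & s],
       ~~ odd (size s) & n = primes_prod [:: p, q & s]]) ->
    (exists t r, [/\ (1 < t)%N, (1 < r)%N,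
       phi m = phi r \Po 'X^t & (phi r)`_1 = 1 \/ (phi r)`_1 = -1]) ->
  complete_intersection S.
Proof.
move=> hS m1 ePS [p [q [s [ss ps es en]]]] [t [r [t1 r1 em cr]]].
have sz : (1 < size (phi r \Po 'X^t))%N.
  by rewrite -em size_phi ltnS totient_gt0 ltnW.
rewrite en em in ePS.
have etpq := cyclotomic_length2_t hS ss ps es t1 sz ePS cr.
have s0 := cyclotomic_length2_s hS ss ps es (phi_coef0 r1) sz ePS etpq.
have [pp pq pltq] := smallest_primes ss ps.
pose b := if t == p then q else p.
have [pt pb tb epq] : [/\ prime t, prime b, t != b & (p * q = t * b)%N].
  rewrite /b; case: etpq => ->; rewrite ?eqxx ?(gtn_eqF pltq); split=> //.
    by rewrite ltn_eqF.
  by rewrite mulnC.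
have {}ePS : semigroup_poly S = phi (t * b) * (phi r \Po 'X^t).
  by rewrite ePS s0 -epq /primes_prod !big_cons big_nil muln1.
have hQ := quotient_semigroup hS pt.
have ePQ := quotient_semigroup_poly hS pt pb tb ePS.
have SE := gluing_of_phi hS pt pb tb ePS.
(* For the quotient this coefficient is an indicator minus 1, so it cannot be 1. Hence [r] has an
   even number of prime factors, and the quotient is [<u, v>] by [cyclotomic_length1]. *)
have cr1 : (phi r)`_1 = -1.
  have := coef_semigroup_poly hQ 1; rewrite ePQ.
  rewrite (@indicT _ 0%N); last exact: semigroup0.
  by case: cr => -> //; have := indic_le1 (quotient_set S t) 1; lra.
have [u [v [s' [ss' ps' es' er]]]] : exists p q s, [/\ sorted ltn [:: p, q & s],
    all prime [:: p, q & s], ~~ odd (size s) & r = primes_prod [:: p, q & s]].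
  by case: (phi_coef1_cases r1) => [|[]|[]]; rewrite cr1 //; lra.
rewrite er in ePQ.
have QE := cyclotomic_length1 hQ ss' ps' es' ePQ.
have [pu pv uv] := smallest_primes ss' ps'.
apply: (complete_intersection_gluing pt pb tb pu pv).
- by rewrite neq_ltn uv.
- apply/QE; rewrite /quotient_set; apply: (semigroupM hS); apply/SE.
  by exists 0%N, 1%N; rewrite muln0 muln1; split=> //; apply: semigroup0.
move=> k; split=> [/SE[i [z [/QE[x [y ->]] ->]]]|[x [y [z ->]]]]; first by exists x, y, z.
by apply/SE; exists (u * x + v * y)%N, z; split=> //; apply/QE; exists x, y.
Qed.

Lemma cyclotomic_complete_intersection (S : set nat) (s : seq nat) :
    numerical_semigroup S -> all (fun n => 0 < n)%N s -> (size s <= 2)%N ->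
    semigroup_poly S = \prod_(n <- s) phi n ->
  complete_intersection S.
Proof.
move=> hS s0 s2 ePS.
have [S1|nS1] := pselect (S 1%N).
  by apply: complete_intersection_setT => k; apply: (semigroup1 hS).
have c1 := semigroup_poly_coef1 hS nS1.
(* The factor [phi 1] vanishes at 1, where the semigroup polynomial is 1. *)
have s1 n : n \in s -> (1 < n)%N.
  move=> ns; rewrite ltn_neqAle (allP s0) // andbT; apply/negP => /eqP n1.
  have := semigroup_poly_horner1 S; rewrite ePS horner_prod (big_rem n) //= -n1 phi1.
  by rewrite -[1]/(1%:P) hornerXsubC subrr mul0r.
case: s ePS s1 {s0} s2 => [|n [|m [|//]]] ePS s1 _.
- by case: nS1; apply: semigroup_poly1 => //; rewrite ePS big_nil.
- have n1 := s1 n (mem_head _ _); rewrite big_seq1 in ePS.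
  rewrite ePS in c1.
  have [p [q [s [ss ps es en]]]] : exists p q s, [/\ sorted ltn [:: p, q & s],
      all prime [:: p, q & s], ~~ odd (size s) & n = primes_prod [:: p, q & s]].
    by case: (phi_coef1_cases n1) => [|[]|[]]; rewrite c1 //; lra.
  rewrite en in ePS; have SE := cyclotomic_length1 hS ss ps es ePS.
  have [pp pq pltq] := smallest_primes ss ps.
  apply: (@complete_intersection2 p q); rewrite ?prime_gt1 //.
    by rewrite prime_coprime // dvdn_prime2 // neq_ltn pltq.
  by move=> k; split=> [/SE|] [x [y ->]]; [|apply/SE]; exists x, y; ring.
have n1 := s1 n (mem_head _ _).
have m1 : (1 < m)%N by apply: s1; rewrite !inE eqxx orbT.
rewrite big_cons big_seq1 in ePS.
(* Each summand is 1, -1 or 0, so one of them is -1 and the other 0. *)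
have csum : (phi n)`_1 + (phi m)`_1 = -1.
  rewrite -c1 ePS coefM !big_ord_recl big_ord0 /= !phi_coef0 //.
  by rewrite mul1r mulr1 addr0 addrC.
have ePS' : semigroup_poly S = phi m * phi n by rewrite mulrC.
case: (phi_coef1_cases n1) (phi_coef1_cases m1) => [cn|[cn hn]|[cn hn]] [cm|[cm hm]|[cm hm]];
  move: csum; rewrite cn cm => csum; try by exfalso; move: csum; lra.
- exact: complete_intersection_length2 hS m1 ePS hn hm.
- exact: complete_intersection_length2 hS n1 ePS' hm hn.
Qed.

End CyclotomicIsCompleteIntersection.

Theorem theorem1p3 (S : set nat) (hS : numerical_semigroup S)
  (hlen : exists2 s : seq {poly rat},
     irreducible_factorization (semigroup_poly S) s & (size s <= 2)%N) :
  cyclotomic_semigroup S <-> complete_intersection S.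
Proof.
split=> [[r r0 ePS]|]; last exact: complete_intersection_cyclotomic.
have {}ePS : semigroup_poly S = (\prod_(n <- r) phi n)%R.
  by rewrite ePS; apply: eq_bigr => n _; rewrite phiE.
have [s [irr es] s2] := hlen.
apply: (cyclotomic_complete_intersection hS r0 _ ePS).
(* Cyclotomic factors are nonconstant, so there are at most as many as irreducible ones. *)
rewrite -(size_map phi); apply: leq_trans s2.
apply: (size_nonconstant_factors irr) => [_ /mapP[n nr ->]|].
  by rewrite size_phi ltnS totient_gt0 (allP r0).
by rewrite big_map -ePS.
Qed.
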